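(* Let $R$ be a left and right noetherian ring (with unity) and let $n\geq 0$ be an integer. The ring $R$ is Iwanaga-Gorenstein of dimension at most $n$ if and only if every left $R$-module and every right $R$-module is trace up to isomorphism in a module (on the same side) of Gorenstein injective dimension at most $n$.
   Context: A ring $R$ is Iwanaga-Gorenstein if it is left and right noetherian and has finite injective dimension both as a left and as a right module over itself; it is of dimension at most $n$ if these injective dimensions are at most $n$. A cochain complex $C^\bullet$ of $R$-modules is a totally acyclic complex of injectives if each $C^i$ is injective and both $C^\bullet$ and $\operatorname{Hom}_R(C^\bullet,J)$ are acyclic for every injective $R$-module $J$. [The paper's definition of total acyclicity is stated with $\operatorname{Hom}_R(C^\bullet,J)$; the standard definition, used in the literature on Gorenstein injective modules, requires $\operatorname{Hom}_R(J,C^\bullet)$ to be acyclic, and this standard version is the one to use.] An $R$-module $G$ is Gorenstein injective if $G\cong\ker(C^0\to C^1)$ for some totally acyclic complex of injectives $C^\bullet$. The Gorenstein injective dimension of an $R$-module $M$ is the least integer $n$ such that there is an exact sequence $0\to M\to G^0\to\cdots\to G^n\to 0$ with each $G^i$ Gorenstein injective. The same definitions apply to right modules (modules over $R^{\mathrm{op}}$). For $R$-modules $M,X$, the trace module of $M$ in $X$ is $\tau_M(X)=\sum_{\alpha\in\operatorname{Hom}_R(M,X)}\alpha(M)\subseteq X$. A submodule $M\subseteq X$ is a trace submodule of $X$ if $M=\tau_N(X)$ for some $R$-module $N$. $M$ is trace in $X$ up to isomorphism if there exists an injective $R$-homomorphism $\iota:M\to X$ such that $\operatorname{Im}(\iota)$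 is a trace submodule of $X$. *)

(* Defs.v *)
From HB Require Import structures.
From mathcomp Require Import all_boot all_order all_algebra.
From mathcomp Require Import boolp classical_sets.

Set Implicit Arguments.
Unset Strict Implicit.
Unset Printing Implicit Defensive.

Import GRing.Theory.
Local Open Scope ring_scope.
Local Open Scope classical_set_scope.

(* Conventions: [pzRingType] is the type of all unital rings, not necessarily
   commutative, the zero ring included. Right R-modules are left modules over
   the converse ring [R^c]; in particular R as a left (right) module over
   itself is [R^o : lmodType R] ([(R^c)^o : lmodType R^c]). *)

Definition kernel (R : pzRingType) (U V : lmodType R) (f : {linear U -> V}) :
  set U := [set x | f x = 0].

Definition exact_at (R : pzRingType) (U V W : lmodType R)
  (f : {linear U -> V}) (g : {linear V -> W}) : Prop := range f = kernel g.

Definition noetherian_module (R : pzRingType) (V : lmodType R) : Prop :=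
  forall I : nat -> set V,
    (forall k, GRing.submod_closed [in I k]) ->
    (forall k, I k `<=` I k.+1) ->
    exists N : nat, forall k : nat, (N <= k)%N -> I k = I N.

Definition left_noetherian (R : pzRingType) : Prop :=
  noetherian_module (R^o : lmodType R).

Definition right_noetherian (R : pzRingType) : Prop := left_noetherian R^c.

Definition injective_module (R : pzRingType) (E : lmodType R) : Prop :=
  forall (A B : lmodType R) (f : {linear A -> B}) (g : {linear A -> E}),
    injective f -> exists h : {linear B -> E}, h \o f =1 g.

(* An exact sequence 0 -> M -> G 0 -> ... -> G m -> 0 with all terms G i in the
   class P, written as an infinite sequence that vanishes beyond degree m. *)
Definition has_coresolution (R : pzRingType) (P : lmodType R -> Prop)
    (M : lmodType R) (m : nat) : Prop :=
  exists (G : nat -> lmodType R) (eta : {linear M -> G 0%N})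
         (d : forall i, {linear G i -> G i.+1}),
    [/\ forall i, (i <= m)%N -> P (G i),
        forall i, (m < i)%N -> forall x : G i, x = 0,
        injective eta,
        exact_at eta (d 0%N)
      & forall i, exact_at (d i) (d i.+1)].

(* The dimension of M relative to P is the least length of a coresolution of M
   by modules in P; it is at most n iff some such length is at most n. *)
Definition coresolution_dim_le (R : pzRingType) (P : lmodType R -> Prop)
    (M : lmodType R) (n : nat) : Prop :=
  exists2 m : nat, (m <= n)%N & has_coresolution P M m.

Definition injective_dim_le (R : pzRingType) (M : lmodType R) (n : nat) : Prop :=
  coresolution_dim_le (@injective_module R) M n.

Definition Iwanaga_Gorenstein (R : pzRingType) : Prop :=
  [/\ left_noetherian R, right_noetherian R,
      exists k, injective_dim_le (R^o : lmodType R) k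
    & exists k, injective_dim_le ((R^c)^o : lmodType R^c) k].

Definition Iwanaga_Gorenstein_dim_le (R : pzRingType) (n : nat) : Prop :=
  [/\ Iwanaga_Gorenstein R,
      injective_dim_le (R^o : lmodType R) n
    & injective_dim_le ((R^c)^o : lmodType R^c) n].

Record cochain_complex (R : pzRingType) := CochainComplex {
  cobj : int -> lmodType R;
  codiff : forall i : int, {linear cobj i -> cobj (i + 1)};
  codiffK : forall (i : int) (x : cobj i), codiff (i + 1) (codiff i x) = 0 }.

(* Every integer is of the form i + 1, so this is exactness in all degrees. *)
Definition acyclic (R : pzRingType) (C : cochain_complex R) : Prop :=
  forall i : int, exact_at (codiff C i) (codiff C (i + 1)).

(* Acyclicity of the complex of abelian groups Hom_R(J, C): every cocycle
   f : J -> C^(i+1) is the image d \o g of some g : J -> C^i. *)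
Definition Hom_acyclic (R : pzRingType) (J : lmodType R)
    (C : cochain_complex R) : Prop :=
  forall (i : int) (f : {linear J -> cobj C (i + 1)}),
    (forall x, codiff C (i + 1) (f x) = 0) ->
    exists g : {linear J -> cobj C i}, codiff C i \o g =1 f.

Definition totally_acyclic_injectives (R : pzRingType)
    (C : cochain_complex R) : Prop :=
  [/\ forall i, injective_module (cobj C i),
      acyclic C
    & forall J : lmodType R, injective_module J -> Hom_acyclic J C].

Definition Gorenstein_injective (R : pzRingType) (G : lmodType R) : Prop :=
  exists2 C : cochain_complex R, totally_acyclic_injectives C &
    exists2 phi : {linear G -> cobj C 0},
      injective phi & range phi = kernel (codiff C 0).

Definition Gorenstein_injective_dim_le (R : pzRingType) (M : lmodType R)
    (n : nat) : Prop :=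
  coresolution_dim_le (@Gorenstein_injective R) M n.

(* The sum of the submodules alpha(M), i.e., all finite sums of elements
   alpha m. *)
Definition trace_module (R : pzRingType) (M X : lmodType R) : set X :=
  [set x | exists s : seq ({linear M -> X} * M), x = \sum_(p <- s) p.1 p.2].

Definition trace_submodule (R : pzRingType) (X : lmodType R) (S : set X) :
  Prop := exists N : lmodType R, S = @trace_module R N X.

Definition trace_up_to_iso (R : pzRingType) (M X : lmodType R) : Prop :=
  exists2 iota : {linear M -> X}, injective iota & trace_submodule (range iota).

(* Main.v *)
Require Import Defs.
From HB Require Import structures.
From mathcomp Require Import all_boot all_order all_algebra.
From mathcomp Require Import boolp classical_sets functions.

(* Trace condition => Gorenstein: if R + M is, up to isomorphism, a trace
   submodule of X, then it is all of X, because R is a generator. So every module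
   is a retract of one of Gorenstein injective dimension at most n, and
   Ext^(n+1)(J, -) = 0 for injective J. Hence J has projective dimension at most
   n, so T (x) J is exact in degrees > n for every resolution T of a cyclic right
   module by finitely generated free ones; as T (x) J = Hom(Hom(T, R), J) and J is
   an arbitrary injective module, Ext^(n+1)(-, R) vanishes on cyclic right
   modules, and Baer's criterion bounds the right injective dimension of R.

   Gorenstein => trace condition: every M is its own trace in itself, so it
   suffices to bound its Gorenstein injective dimension by n. If T is an exact
   complex of finitely generated free right modules, then T (x) L is exact for L
   injective (right injective dimension of R finite) or projective, hence for all
   syzygies L of an injective module J (right noetherian); such L have injective
   dimension at most n (left noetherian, left injective dimension of R at most n).
   So the resolution of J splits after n steps, Ext^(n+1)(J, -) = 0, and every
   n-th cosyzygy C of a module M satisfies Ext^1(J, C) = 0. A free module F onto M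
   with kernel Z yields, by the horseshoe lemma, an exact sequence
   0 -> Z' -> F' -> C -> 0 of n-th cosyzygies with F' injective; iterating this
   gives the left half of a totally acyclic complex of injectives for C. *)

Set Implicit Arguments.
Unset Strict Implicit.
Unset Printing Implicit Defensive.

Import GRing.Theory.
Local Open Scope ring_scope.

(** * Submodules and quotient modules *)

Definition submodule_set (R : pzRingType) (V : lmodType R) (S : set V) : Prop :=
  S 0 /\ forall a u v, S u -> S v -> S (a *: u + v).

Section Submodule.
Variables (R : pzRingType) (V : lmodType R) (S : set V).
Hypothesis S_submod : submodule_set S.

(** The proof of closure is an argument of the type, so that the module structure can be attached to
    the type as a canonical instance. *)
Definition submodule_of of submodule_set S := {x : V | `[< S x >]}.
Notation T := (submodule_of S_submod).
HB.instance Definition _ := [isSub of T for @sval V _].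
HB.instance Definition _ := [Choice of T by <:].

Lemma submodule_set_closed : GRing.subsemimod_closed [pred x : V | `[< S x >]].
Proof.
apply: GRing.submod_closed_semi; case: S_submod => S0 SD.
split=> [|a u v]; first exact/asboolP.
by move=> /asboolP Su /asboolP Sv; apply/asboolP/SD.
Qed.

HB.instance Definition _ := GRing.SubChoice_isSubLmodule.Build R V
  [pred x : V | `[< S x >]] T submodule_set_closed.

Lemma submodule_inclusion : exists (K : lmodType R) (k : {linear K -> V}),
  injective k /\ forall x, S x <-> exists y, k y = x.
Proof.
exists T, (\val : {linear T -> V}); split; first exact: val_inj.
move=> x; split=> [Sx|[y <-]]; last by apply/asboolP; exact: (valP y).
by have Px : `[< S x >] by [apply/asboolP]; exists (Sub x Px); exact: SubK.
Qed.
End Submodule.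

Lemma linear_of_fun (R : pzRingType) (U V : lmodType R) (f : U -> V) :
  (forall a u v, f (a *: u + v) = a *: f u + f v) ->
  exists g : {linear U -> V}, g =1 f.
Proof.
move=> fL; pose M := GRing.isLinear.Build R U V _ f fL.
pose g : {linear U -> V} := HB.pack f M.
by exists g.
Qed.

Section Quotient.
Variables (R : pzRingType) (V : lmodType R) (S : set V).
Hypothesis S_submod : submodule_set S.

(** The quotient is realised as the type of chosen representatives, one in each coset. *)
Definition coset_repr (x : V) : V := xget 0 [set y | S (x - y)].

Lemma submodule_setB u v : S u -> S v -> S (u - v).
Proof.
case: S_submod => S0 SD Su Sv; rewrite addrC -scaleN1r; exact: SD.
Qed.

Lemma submodule_setN u : S u -> S (- u).
Proof. by move=> /(submodule_setB S_submod.1); rewrite sub0r. Qed.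

Lemma submodule_setD u v : S u -> S v -> S (u + v).
Proof. by move=> Su /submodule_setN /(submodule_setB Su); rewrite opprK. Qed.

Lemma coset_reprP x : S (x - coset_repr x).
Proof.
rewrite /coset_repr; case: xgetP => [y _ //|/(_ x)] [] /=.
by rewrite subrr; exact: S_submod.1.
Qed.

(** Congruent elements have the same set of candidates, and [xget] picks the same element from equal
    sets. *)
Lemma eq_coset_repr x y : (coset_repr x = coset_repr y) <-> S (x - y).
Proof.
split=> [e|Sxy].
  have := submodule_setB (coset_reprP x) (coset_reprP y).
  by rewrite e opprB addrA subrK.
congr xget; apply/seteqP; split=> z /= Sz.
  by have := submodule_setB Sz Sxy; rewrite opprB addrC addrA subrK.
by have := submodule_setD Sxy Sz; rewrite addrA subrK.
Qed.

Lemma coset_repr_id x : coset_repr (coset_repr x) = coset_repr x.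
Proof.
by apply/eq_coset_repr; rewrite -opprB; exact/submodule_setN/coset_reprP.
Qed.

Definition quotient_of of submodule_set S := {x : V | coset_repr x == x}.
Notation T := (quotient_of S_submod).
HB.instance Definition _ := [isSub of T for @sval V _].
HB.instance Definition _ := [Choice of T by <:].

Definition quotient_proj (x : V) : T :=
  exist _ (coset_repr x) (introT eqP (coset_repr_id x)).

Lemma eq_quotient_proj x y : quotient_proj x = quotient_proj y <-> S (x - y).
Proof.
rewrite -eq_coset_repr; split=> [/(congr1 val) //|e].
exact: val_inj.
Qed.

Lemma val_quotient_proj x : S (val (quotient_proj x) - x).
Proof. by rewrite -opprB; exact/submodule_setN/coset_reprP. Qed.

Lemma valK_quotient (x : T) : quotient_proj (val x) = x.
Proof. by apply: val_inj; apply/eqP; exact: (valP x). Qed.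

Definition quotient_add (x y : T) : T := quotient_proj (val x + val y).
Definition quotient_opp (x : T) : T := quotient_proj (- val x).
Definition quotient_scale (a : R) (x : T) : T := quotient_proj (a *: val x).

Lemma quotient_projD x y :
  quotient_proj (x + y) = quotient_add (quotient_proj x) (quotient_proj y).
Proof.
apply/eq_quotient_proj; rewrite opprD addrACA.
by apply: submodule_setD; exact: coset_reprP.
Qed.

Lemma quotient_projN x : quotient_proj (- x) = quotient_opp (quotient_proj x).
Proof. apply/eq_quotient_proj; rewrite opprK addrC; exact: val_quotient_proj. Qed.

Lemma quotient_projZ a x :
  quotient_proj (a *: x) = quotient_scale a (quotient_proj x).
Proof.
apply/eq_quotient_proj; rewrite -scalerBr -[_ *: _]addr0.
by apply: S_submod.2; [exact: coset_reprP | exact: S_submod.1].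
Qed.

Lemma quotient_addA : associative quotient_add.
Proof.
move=> x y z; rewrite -(valK_quotient x) -(valK_quotient y) -(valK_quotient z).
by rewrite -!quotient_projD addrA.
Qed.
Lemma quotient_addC : commutative quotient_add.
Proof. by move=> x y; rewrite /quotient_add addrC. Qed.
Lemma quotient_add0 : left_id (quotient_proj 0) quotient_add.
Proof.
by move=> x; rewrite -(valK_quotient x) -quotient_projD add0r.
Qed.
Lemma quotient_addN : left_inverse (quotient_proj 0) quotient_opp quotient_add.
Proof.
by move=> x; rewrite -(valK_quotient x) -quotient_projN -quotient_projD addNr.
Qed.
HB.instance Definition _ := GRing.isZmodule.Build T
  quotient_addA quotient_addC quotient_add0 quotient_addN.

Lemma quotient_scaleA a b (x : T) :
  quotient_scale a (quotient_scale b x) = quotient_scale (a * b) x.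
Proof. by rewrite -(valK_quotient x) -!quotient_projZ scalerA. Qed.
Lemma quotient_scale1 : left_id 1 quotient_scale.
Proof. by move=> x; rewrite -(valK_quotient x) -quotient_projZ scale1r. Qed.
Lemma quotient_scaleDr : right_distributive quotient_scale quotient_add.
Proof.
move=> a x y; rewrite -(valK_quotient x) -(valK_quotient y).
by rewrite -quotient_projD -!quotient_projZ -quotient_projD scalerDr.
Qed.
Lemma quotient_scaleDl (x : T) :
  {morph quotient_scale^~ x : a b / a + b >-> quotient_add a b}.
Proof.
move=> a b /=; rewrite -(valK_quotient x) -!quotient_projZ.
by rewrite -quotient_projD scalerDl.
Qed.
HB.instance Definition _ := GRing.Zmodule_isLmodule.Build R T
  quotient_scaleA quotient_scale1 quotient_scaleDr quotient_scaleDl.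

Lemma quotient_projection : exists (Q : lmodType R) (q : {linear V -> Q}),
  (forall y, exists x, q x = y) /\ forall x, q x = 0 <-> S x.
Proof.
have [a u v|q qE] := @linear_of_fun R V T quotient_proj.
  by rewrite quotient_projD quotient_projZ.
exists T, q; split=> [y|x]; first by exists (val y); rewrite qE valK_quotient.
by rewrite qE -[X in S X]subr0 -eq_quotient_proj.
Qed.
End Quotient.

(** Any set-theoretic section of [p] will do, since [f] does not see the choice of preimages. *)
Lemma linear_factor_surj (R : pzRingType) (U V W : lmodType R)
    (p : {linear V -> W}) (f : {linear V -> U}) :
  (forall y, exists x, p x = y) -> (forall x, p x = 0 -> f x = 0) ->
  exists g : {linear W -> U}, forall x, g (p x) = f x.
Proof.
move=> p_surj pf; have [s sP] := choice p_surj.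
have fs x : f (s (p x)) = f x.
  by apply/eqP; rewrite -subr_eq0 -linearB pf // linearB sP subrr.
have [a u v|g gE] := @linear_of_fun R W U (f \o s).
  by rewrite /= -linearP -[in RHS]fs linearP !sP.
by exists g => x; rewrite gE /= fs.
Qed.

Lemma linear_factor_inj (R : pzRingType) (A B V : lmodType R)
    (i : {linear A -> B}) (f : {linear V -> B}) :
  injective i -> (forall x, exists a, i a = f x) ->
  exists g : {linear V -> A}, forall x, i (g x) = f x.
Proof.
move=> i_inj /choice[g gP].
have [a u v|h hE] := @linear_of_fun R V A g.
  by apply: i_inj; rewrite gP linearP linearP !gP.
by exists h => x; rewrite hE gP.
Qed.

(** * Free modules *)

Lemma linear_fun_sum (R : pzRingType) (U V : lmodType R) (X : eqType)
    (s : seq X) (c : X -> {linear U -> (R^o : lmodType R)}) (g : X -> V) :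
  exists h : {linear U -> V}, forall u, h u = \sum_(x <- s) (c x u : R) *: g x.
Proof.
have [a u v|h hE] := @linear_of_fun R U V (fun u => \sum_(x <- s) (c x u : R) *: g x).
  rewrite scaler_sumr -big_split /=; apply: eq_bigr => x _.
  by rewrite linearP scalerDl scalerA.
by exists h.
Qed.

Lemma big_uniq_support (V : nmodType) (X : eqType) (s t : seq X) (F : X -> V) :
  uniq s -> uniq t -> (forall x, x \notin s -> F x = 0) ->
  (forall x, x \notin t -> F x = 0) ->
  \sum_(x <- s) F x = \sum_(x <- t) F x.
Proof.
move=> us ut Fs Ft.
have E r : \sum_(x <- r) F x = \sum_(x <- [seq x <- r | F x != 0]) F x.
  rewrite (bigID (fun x => F x != 0)) /= [X in _ + X]big1 ?addr0 ?big_filter //.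
  by move=> x /negPn/eqP.
rewrite E [RHS]E; apply/perm_big/uniq_perm; rewrite ?filter_uniq // => x.
rewrite !mem_filter; have [//|Fx] := eqVneq (F x) 0.
by rewrite (contra_neqT (Fs x) Fx) (contra_neqT (Ft x) Fx).
Qed.

(** Finite support is expressed by a list such that every duplicate-free list containing it expands
    [z]; several elements can thus be expanded over one common list. *)
Lemma free_module (R : pzRingType) (X : choiceType) :
  exists (F : lmodType R) (e : X -> F) (c : X -> {linear F -> (R^o : lmodType R)}),
    (forall z, exists s : seq X, forall t : seq X, uniq t -> {subset s <= t} ->
       z = \sum_(x <- t) (c x z : R) *: e x) /\
    (forall (N : lmodType R) (g : X -> N),
       exists h : {linear F -> N}, forall x, h (e x) = g x).
Proof.
(* The functions of finite support; [e x] will be the indicator of [x] and [c x] the evaluation at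
   [x]. *)
pose S : set (X -> R^o) := fun f => exists s : seq X, forall x, x \notin s -> f x = 0.
have S_sub : submodule_set S.
  split=> [|a u v [s us] [t vt]]; first by exists [::].
  exists (s ++ t) => x; rewrite mem_cat negb_or => /andP[/us ux /vt vx].
  by rewrite !fctE ux vx scaler0 addr0.
have [F [k [k_inj kS]]] := submodule_inclusion S_sub.
have /choice[e eE] x : exists z : F, forall y, k z y = (y == x)%:R.
  have /kS[z zE] : S (fun y => (y == x)%:R).
    by exists [:: x] => y; rewrite inE => /negbTE ->.
  by exists z => y; rewrite zE.
have /choice[c cE] x : exists cx : {linear F -> (R^o : lmodType R)},
    forall z, cx z = k z x.
  have [a u v|cx cxE] := @linear_of_fun R F R^o (fun z => k z x).
    by rewrite linearP.
  by exists cx.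
have /choice[s sP] z : exists s : seq X, uniq s /\ forall x, x \notin s -> c x z = 0.
  have /kS[s sP] : exists z', k z' = k z by exists z.
  by exists (undup s); rewrite undup_uniq; split=> // x; rewrite mem_undup cE => /sP.
exists F, e, c; split=> [z|N g].
  exists (s z) => t ut st; apply: k_inj; apply/funext => y.
  rewrite linear_sum /= fct_sumE.
  rewrite (eq_bigr (fun x => if x == y then k z y else 0)); last first.
    move=> x _; rewrite linearZ_LR fctE eE cE eq_sym.
    by case: eqVneq => [->|_]; [exact: mulr1 | exact: mulr0].
  have [yt|yt] := boolP (y \in t).
    rewrite (bigD1_seq y) //= eqxx big1 ?addr0 // => x /negbTE -> //.
  rewrite big1_seq => [|x /andP[_ xt]]; last first.
    by case: eqVneq xt yt => // -> ->.
  by rewrite -cE (sP z).2 //; apply: contraNN yt; exact: st.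
have [a u v|h hE] := @linear_of_fun R F N
    (fun z => \sum_(x <- s z) (c x z : R) *: g x).
  pose r := undup (s (a *: u + v) ++ s u ++ s v).
  have E z : {subset s z <= r} ->
      \sum_(x <- s z) (c x z : R) *: g x = \sum_(x <- r) (c x z : R) *: g x.
    move=> zr; apply: big_uniq_support; rewrite ?undup_uniq ?(sP z).1 //.
      by move=> x /(sP z).2 ->; rewrite scale0r.
    by move=> x xr; rewrite (sP z).2 ?scale0r //; apply: contraNN xr; exact: zr.
  rewrite !E; try by move=> x xs; rewrite mem_undup !mem_cat xs ?orbT.
  rewrite scaler_sumr -big_split /=; apply: eq_bigr => x _.
  by rewrite linearP scalerDl scalerA.
exists h => x; rewrite hE (big_uniq_support (t := [:: x])) ?(sP _).1 //.
- by rewrite big_seq1 cE eE eqxx scale1r.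
- by move=> y /(sP _).2 ->; rewrite scale0r.
- by move=> y; rewrite inE cE eE => /negbTE; rewrite eq_sym => ->; rewrite scale0r.
Qed.

(** * Baer's criterion *)

Definition projective_module (R : pzRingType) (P : lmodType R) : Prop :=
  forall (V W : lmodType R) (p : {linear V -> W}) (f : {linear P -> W}),
    (forall y, exists x, p x = y) -> exists g : {linear P -> V}, forall x, p (g x) = f x.

Definition short_exact (R : pzRingType) (A B C : lmodType R)
    (i : {linear A -> B}) (p : {linear B -> C}) : Prop :=
  [/\ injective i, forall y, p y = 0 <-> exists x, i x = y
    & forall z, exists y, p y = z].

Lemma kernel_short_exact (R : pzRingType) (V W : lmodType R) (p : {linear V -> W}) :
  (forall y, exists x, p x = y) ->
  exists (K : lmodType R) (i : {linear K -> V}), short_exact i p.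
Proof.
move=> p_surj.
have [|K [i [i_inj iK]]] := @submodule_inclusion R V (fun x => p x = 0).
  by split=> [|a u v pu pv]; rewrite ?linear0 // linearP pu pv scaler0 addr0.
by exists K, i; split.
Qed.

Lemma range_submodule (R : pzRingType) (V W : lmodType R) (f : {linear V -> W}) :
  submodule_set (fun y => exists x, f x = y).
Proof.
split=> [|a u v [x <-] [y <-]]; first by exists 0; rewrite linear0.
by exists (a *: x + y); rewrite linearP.
Qed.

Lemma cokernel_short_exact (R : pzRingType) (V W : lmodType R) (i : {linear V -> W}) :
  injective i -> exists (Q : lmodType R) (p : {linear W -> Q}), short_exact i p.
Proof.
move=> i_inj; have [Q [p [p_surj pS]]] := quotient_projection (range_submodule i).
by exists Q, p; split.
Qed.

Lemma enough_projectives (R : pzRingType) (M : lmodType R) :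
  exists (K P : lmodType R) (i : {linear K -> P}) (p : {linear P -> M}),
    projective_module P /\ short_exact i p.
Proof.
have [F [e [c [cP Fu]]]] := free_module R M.
have [p pe] := Fu M id.
have p_surj y : exists x, p x = y by exists (e y); rewrite pe.
have [K [i ip]] := kernel_short_exact p_surj.
exists K, F, i, p; split=> // V W q f q_surj.
have /choice[s sP] m : exists x, q x = f (e m) by exact: q_surj.
have [g ge] := Fu V s; exists g => z.
have [t /(_ (undup t) (undup_uniq t)) ->] := cP z.
  by rewrite !linear_sum; apply: eq_bigr => x _; rewrite !linearZ_LR ge sP.
by move=> x; rewrite mem_undup.
Qed.

(** Zorn's lemma gives a maximal partial extension of [g], kept as a graph in [B * E]; the
    hypothesis on ideals extends it to any further [b]. The function [phi] lives on all of [R] but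
    is linear only on [I], so that [I] need not be made into a module. *)
Lemma Baer_criterion (R : pzRingType) (E : lmodType R) :
  (forall (I : set (R^o : lmodType R)) (phi : R -> E), submodule_set I ->
     (forall a u v : R, I u -> I v -> phi (a * u + v) = a *: phi u + phi v) ->
     exists e, forall r : R, I r -> phi r = r *: e) ->
  injective_module E.
Proof.
move=> hE A B f g f_inj.
pose good (G : set (B * E)%type) := [/\ submodule_set G,
  forall e, G (0, e) -> e = 0 & forall a, G (f a, g a)].
pose G0 : set (B * E)%type := fun z => exists a, (f a, g a) = z.
have G0good : good G0.
  split=> [|e [a [fa <-]]|a]; last by exists a.
    split=> [|c _ _ [x <-] [y <-]]; first by exists 0; rewrite !linear0.
    by exists (c *: x + y); rewrite !linearP.
  by rewrite (f_inj a 0) ?linear0.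
(* The disjunct [G = set0] accounts for the union of the empty chain. *)
have [|G [Ggood Gmax]] := @Zorn_bigcup (B * E)%type (fun G => G = set0 \/ good G).
  move=> F FP Ftot.
  have [[X FX Xgood]|none] := pselect (exists2 X, F X & good X); last first.
    left; apply/seteqP; split=> // z [X FX Xz].
    case: (FP _ FX) => [X0|Xg]; first by rewrite X0 in Xz.
    by case: none; exists X.
  right; case: (Xgood) => -[X0 XD] Xf Xg; split=> [|e [Y FY Ye]|a].
  - split=> [|a u v [Y FY Yu] [Z FZ Zv]]; first by exists X.
    have goodY z T : F T -> T z -> good T.
      by move=> /FP[->//|].
    have [YZ|ZY] := Ftot _ _ FY FZ.
      by exists Z => //; case: (goodY v Z FZ Zv) => -[_ ZD] _ _; apply: ZD; first exact: YZ.
    by exists Y => //; case: (goodY u Y FY Yu) => -[_ YD] _ _; apply: YD => //; exact: ZY.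
  - by case: (FP _ FY) => [Y0|[_ + _]]; [rewrite Y0 in Ye | exact].
  - by exists X.
have {}Ggood : good G.
  case: Ggood => // G_0; case: (Gmax G0); last by right.
  by rewrite G_0; split=> [//|/(_ (f 0, g 0))]; apply; exists 0.
case: (Ggood) => Gsub Gf Gg; case: (Gsub) => G00 GD.
have GfP b e e' : G (b, e) -> G (b, e') -> e = e'.
  move=> be be'; apply/eqP; rewrite -subr_eq0; apply/eqP/Gf.
  by have : G (b - b, e - e') := submodule_setB Gsub be be'; rewrite subrr.
have Gtot b : exists e, G (b, e).
  (* The scalars that bring [b] into the domain of [G]; on them [phi r] is the value at [r *: b]. *)
  pose I : set (R^o : lmodType R) := fun r : R => exists e, G (r *: b, e).
  have /choice[phi phiP] (r : R) : exists e, I r -> G (r *: b, e).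
    by have [[e Ge]|nI] := pselect (I r); [exists e | exists 0].
  have Isub : submodule_set I.
    split=> [|a u v [x Gx] [y Gy]]; first by exists 0; rewrite scale0r.
    exists (a *: x + y); have := GD a _ _ Gx Gy.
    by rewrite scalerDl -scalerA.
  have [a u v Iu Iv|e eP] := hE I phi Isub.
    apply: GfP (phiP _ _) _; first exact: Isub.2.
    rewrite scalerDl -scalerA; exact: GD a _ _ (phiP _ Iu) (phiP _ Iv).
  pose G' : set (B * E)%type := fun z => exists r x, G x /\ z = r *: (b, e) + x.
  have GG' z : G z -> G' z.
    by move=> Gz; exists 0, z; rewrite scale0r add0r.
  have G'b : G' (b, e).
    by exists 1, 0; rewrite scale1r addr0.
  apply: contrapT => nb; apply: (Gmax G').
    by split=> // /(_ _ G'b) Gbe; apply: nb; exists e.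
  right; split=> [|x [r [[y z] [Gyz [y0 ->]]]]|a]; last exact/GG'.
    split=> [|a _ _ [r [x [Gx ->]]] [s [y [Gy ->]]]]; first exact/GG'.
    exists (a * r + s), (a *: x + y); split; first exact: GD.
    by rewrite scalerDl scalerDr scalerA addrACA.
  (* The enlarged graph is single-valued: if r b + y = 0, then r b is already in the domain, with
     value both [- z] and [r *: e]. *)
  have Gr : G (r *: b, - z).
    have -> : r *: b = - y by apply/eqP; rewrite -addr_eq0 -y0.
    exact: submodule_setN Gyz.
  have Ir : I r by exists (- z).
  by rewrite -eP // (GfP _ _ _ (phiP _ Ir) Gr) addNr.
have [h hP] := choice Gtot.
have [a u v|k kE] := @linear_of_fun R B E h.
  by apply: GfP (hP _) _; exact: GD a _ _ (hP _) (hP _).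
by exists k => a /=; rewrite kE; exact: GfP (hP _) (Gg a).
Qed.

(** * Enough injective modules *)

(** An ideal of the integers is generated by its least positive element [d]; dividing [phi d] by [d]
    gives the element that Baer's criterion demands. *)
Lemma divisible_injective (G : lmodType int) :
  (forall (n : int) (x : G), n != 0 -> exists y, n *: y = x) ->
  injective_module G.
Proof.
move=> Gdiv; apply: Baer_criterion => I phi I_sub phiP.
have I0 : I 0 := I_sub.1.
have phi0 : phi 0 = 0.
  by have := phiP (-1) 0 0 I0 I0; rewrite mulr0 addr0 scaleN1r addNr.
have IZ (a u : int) : I u -> I (a * u).
  by move=> Iu; have := I_sub.2 a u 0 Iu I0; rewrite addr0.
have phiZ (a u : int) : I u -> phi (a * u) = a *: phi u.
  by move=> Iu; have := phiP a u 0 Iu I0; rewrite !addr0 phi0 addr0.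
have [ex|nex] := pselect (exists n : nat, (0 < n)%N && `[< I n%:Z >]); last first.
  exists 0 => r Ir; rewrite scaler0; have [->//|r0] := eqVneq r 0.
  case: nex; exists `|r|%N; rewrite absz_gt0 r0; apply/asboolP.
  by rewrite abszEsg; exact: IZ.
case: (ex_minnP ex) => d /andP[d_gt0 /asboolP Id] d_min.
have [|e dE] := Gdiv d%:Z (phi d%:Z); first by rewrite -lt0n in d_gt0 *; case: d d_gt0 {Id d_min}.
exists e => r Ir.
have d0 : d%:Z != 0 by case: d d_gt0 {Id d_min dE}.
have Imod : I (r %% d%:Z)%Z.
  rewrite /modz addrC -mulNr.
  by have := I_sub.2 (- (r %/ d%:Z)%Z) d%:Z r Id Ir.
have r_eq : r = (r %/ d%:Z)%Z * d%:Z.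
  rewrite {1}(divz_eq r d%:Z); case: (r %% d%:Z)%Z (modz_ge0 r d0) (ltz_mod r d0) Imod => // -[|m] _ md Im.
    by rewrite addr0.
  have : (d <= m.+1)%N by apply: d_min; apply/andP; split=> //; apply/asboolP.
  by rewrite leqNgt; move: md; rewrite ltz_nat => ->.
by rewrite [in LHS]r_eq phiZ // -dE scalerA -r_eq.
Qed.

Lemma linear_int (A B : lmodType int) (f : A -> B) :
  {morph f : x y / x + y} -> exists g : {linear A -> B}, g =1 f.
Proof.
move=> fD; have f0 : f 0 = 0 by apply: (addrI (f 0)); rewrite -fD !addr0.
have fN x : f (- x) = - f x by apply: (addrI (f x)); rewrite -fD !subrr.
have fn (n : nat) x : f (n%:Z *: x) = n%:Z *: f x.
  elim: n => [|n IHn]; first by rewrite !scale0r.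
  by rewrite intS !scalerDl !scale1r fD IHn.
have fZ (n : int) x : f (n *: x) = n *: f x.
  by case: n => n //; rewrite NegzE !scaleNr fN fn.
have [a u v|g gE] := @linear_of_fun _ A B f; first by rewrite fD fZ.
by exists g.
Qed.

(* Write M as F / K with F free; F embeds in the rational functions on M, and
   the quotient of these by K is divisible and contains M. *)
Lemma embed_divisible (M : lmodType int) :
  exists (G : lmodType int) (j : {linear M -> G}), injective_module G /\ injective j.
Proof.
have [F [e [c [cP Fu]]]] := free_module int M.
have [p pe] := Fu M id.
have p_surj y : exists x, p x = y by exists (e y); rewrite pe.
pose Q : lmodType int := zmodule rat.
pose D : lmodType int := (M -> Q).
have [x y|k kE] := @linear_int F D (fun z x => ((c x z : int)%:~R : rat)).
  by apply/funext => m; rewrite linearD fctE intrD.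
have k_inj : injective k.
  move=> x y /eqP; rewrite -subr_eq0 -linearB => /eqP kxy.
  apply/eqP; rewrite -subr_eq0; have [s /(_ (undup s)) ->] := cP (x - y).
  - rewrite big1 // => m _; have /eqP : k (x - y) m = 0 by rewrite kxy.
    by rewrite kE intr_eq0 => /eqP ->; rewrite scale0r.
  - exact: undup_uniq.
  - by move=> m; rewrite mem_undup.
pose S : set D := fun z => exists x, p x = 0 /\ k x = z.
have S_sub : submodule_set S.
  split=> [|a _ _ [x [px <-]] [y [py <-]]]; first by exists 0; rewrite !linear0.
  by exists (a *: x + y); rewrite !linearP px py scaler0 addr0.
have [G [q [q_surj qS]]] := quotient_projection S_sub.
have [x px|j jp] := linear_factor_surj (f := q \o k) p_surj.
  by apply/qS; exists x.
exists G, j; split.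
  apply: divisible_injective => n x n0; have [y <-] := q_surj x.
  exists (q (fun m => y m / n%:~R)); rewrite -linearZ_LR; congr (q _).
  apply/funext => m; rewrite fctE scalezrE -mulrzr mulfVK //.
  by rewrite intr_eq0.
move=> x y /eqP; rewrite -subr_eq0 -linearB => /eqP.
have [z <-] := p_surj x; have [t <-] := p_surj y.
rewrite -linearB jp /= => /qS[u [pu /k_inj ztu]].
by apply/eqP; rewrite -subr_eq0 -linearB -ztu pu.
Qed.

Section Coinduction.
Variables (R : pzRingType) (G : zmodType).

Definition coinduced :=
  {f : R -> G | `[< forall x y, f (x + y) = f x + f y >]}.
HB.instance Definition _ := [isSub of coinduced for @sval (R -> G) _].
HB.instance Definition _ := [Choice of coinduced by <:].

Lemma coinduced_closed :
  GRing.zmod_closed [pred f : R -> G | `[< forall x y, f (x + y) = f x + f y >]].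
Proof.
split=> [|f g /asboolP fD /asboolP gD]; apply/asboolP => x y.
  by rewrite addr0.
by rewrite !fctE fD gD opprD addrACA.
Qed.
HB.instance Definition _ := GRing.SubChoice_isSubZmodule.Build (R -> G)
  [pred f : R -> G | `[< forall x y, f (x + y) = f x + f y >]] coinduced
  coinduced_closed.

Lemma coinducedD (f : coinduced) x y : val f (x + y) = val f x + val f y.
Proof. by move/asboolP: (valP f); exact. Qed.

Lemma coinduced_scale_additive (a : R) (f : coinduced) :
  `[< forall x y, val f ((x + y) * a) = val f (x * a) + val f (y * a) >].
Proof. by apply/asboolP => x y; rewrite mulrDl coinducedD. Qed.

(** Right multiplication of the argument makes Hom_Z(R, G) a left module. *)
Definition coinduced_scale (a : R) (f : coinduced) : coinduced :=
  exist _ (fun x => val f (x * a)) (coinduced_scale_additive a f).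

Lemma coinduced_scaleA a b f :
  coinduced_scale a (coinduced_scale b f) = coinduced_scale (a * b) f.
Proof. by apply: val_inj; apply/funext => x /=; rewrite mulrA. Qed.
Lemma coinduced_scale1 : left_id 1 coinduced_scale.
Proof. by move=> f; apply: val_inj; apply/funext => x /=; rewrite mulr1. Qed.
Lemma coinduced_scaleDr : right_distributive coinduced_scale +%R.
Proof. by move=> a f g; apply: val_inj; apply/funext. Qed.
Lemma coinduced_scaleDl f : {morph coinduced_scale^~ f : a b / a + b}.
Proof.
by move=> a b; apply: val_inj; apply/funext => x /=; rewrite mulrDr coinducedD.
Qed.
HB.instance Definition _ := GRing.Zmodule_isLmodule.Build R coinduced
  coinduced_scaleA coinduced_scale1 coinduced_scaleDr coinduced_scaleDl.
End Coinduction.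

(* Hom_Z(R, G) is injective over R when G is injective over Z. *)
Lemma enough_injectives (R : pzRingType) (M : lmodType R) :
  exists (E Q : lmodType R) (i : {linear M -> E}) (p : {linear E -> Q}),
    injective_module E /\ short_exact i p.
Proof.
have [G [j [G_inj j_inj]]] := embed_divisible (zmodule M).
pose E : lmodType R := coinduced R G.
have i_ex (m : M) : exists z : coinduced R G, forall r, val z r = j (r *: m).
  have P : `[< forall x y, j ((x + y) *: m) = j (x *: m) + j (y *: m) >].
    by apply/asboolP => x y; rewrite scalerDl (linearD j).
  by exists (exist _ (fun r => j (r *: m)) P).
have [i0 iE] := choice i_ex.
have [a u v|i iE'] := @linear_of_fun R M E i0.
  apply: val_inj; apply/funext => r; rewrite iE scalerDr (linearD j) scalerA.
  by rewrite -iE -(iE v).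
have i_inj : injective i.
  move=> x y; rewrite !iE' => /(congr1 (fun z => val z 1)).
  by rewrite !iE !scale1r => /j_inj.
have [Q [p ip]] := cokernel_short_exact i_inj.
exists E, Q, i, p; split=> // A B f g f_inj.
have [x y|f' f'E] := @linear_int (zmodule A) (zmodule B) f; first exact: linearD.
(* Evaluation at 1 identifies Hom_R(A, Hom_Z(R, G)) with Hom_Z(A, G). The extension [h] found there
   is carried back as the map sending [b] to the function r |-> h (r b). *)
have [x y|g' g'E] := @linear_int (zmodule A) G (fun a => val (g a) 1).
  by rewrite (linearD g).
have f'_inj : injective f' by move=> x y; rewrite !f'E => /f_inj.
have [h hf] := G_inj _ _ f' g' f'_inj.
have k_ex (b : B) : exists z : coinduced R G, forall r, val z r = h (r *: b).
  have P : `[< forall x y, h ((x + y) *: b) = h (x *: b) + h (y *: b) >].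
    by apply/asboolP => x y; rewrite scalerDl (linearD h).
  by exists (exist _ (fun r => h (r *: b)) P).
have [k0 kE] := choice k_ex.
have [a u v|k kE'] := @linear_of_fun R B E k0.
  apply: val_inj; apply/funext => r; rewrite kE scalerDr (linearD h) scalerA.
  by rewrite -kE -(kE v).
exists k => a /=; rewrite kE'; apply: val_inj; apply/funext => r; rewrite kE.
rewrite -linearZ_LR -f'E; have /= -> := hf (r *: a).
by rewrite g'E linearZ_LR /= mul1r.
Qed.

(** * Dimension shifting *)

Definition exact_pair (R : pzRingType) (A B C : lmodType R)
    (f : {linear A -> B}) (g : {linear B -> C}) : Prop :=
  forall y, g y = 0 <-> exists x, f x = y.

(* Exactness of Hom(V2, N) -> Hom(V1, N) -> Hom(V0, N); on a projective
   resolution it expresses the vanishing of Ext. *)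
Definition Hom_exact (R : pzRingType) (V0 V1 V2 : lmodType R)
    (d0 : {linear V0 -> V1}) (d1 : {linear V1 -> V2}) (N : lmodType R) : Prop :=
  forall f : {linear V1 -> N}, (forall x, f (d0 x) = 0) ->
    exists g : {linear V2 -> N}, forall x, g (d1 x) = f x.

Lemma linear_sub (R : pzRingType) (U V : lmodType R) (f g : {linear U -> V}) :
  exists h : {linear U -> V}, forall x, h x = f x - g x.
Proof.
have [a u v|h hE] := @linear_of_fun R U V (fun x => f x - g x).
  by rewrite (linearP f) (linearP g) scalerBr opprD addrACA.
by exists h.
Qed.

Section HomExact.
Variable R : pzRingType.
Implicit Types (C E J L M N P V W : lmodType R).

Lemma injective_extension E V W (i : {linear V -> W}) (f : {linear V -> E}) :
  injective_module E -> injective i ->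
  exists g : {linear W -> E}, forall x, g (i x) = f x.
Proof. by move=> E_inj i_inj; have [g gE] := E_inj _ _ i f i_inj; exists g => x; exact: gE. Qed.

(** By exactness V1 / im d0 embeds in V2, and [f] factors through this quotient. *)
Lemma Hom_exact_injective V0 V1 V2 (d0 : {linear V0 -> V1})
    (d1 : {linear V1 -> V2}) J :
  exact_pair d0 d1 -> injective_module J -> Hom_exact d0 d1 J.
Proof.
move=> ex J_inj f fd0.
have [Q [q [q_surj qd0]]] := quotient_projection (range_submodule d0).
have [x /qd0[y <-]//|f' f'q] := linear_factor_surj (f := f) q_surj.
have [x /qd0 /ex //|d1' d1'q] := linear_factor_surj (f := d1) q_surj.
have d1'_inj : injective d1'.
  move=> x y /eqP; rewrite -subr_eq0 -linearB; have [u <-] := q_surj x.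
  have [v <-] := q_surj y; rewrite -linearB d1'q => /eqP /ex /qd0.
  by rewrite linearB => /eqP; rewrite subr_eq0 => /eqP.
have [g gd] := injective_extension f' J_inj d1'_inj.
by exists g => x; rewrite -d1'q gd f'q.
Qed.

(** It suffices to test against an injective module containing V1 / im d0. *)
Lemma exact_of_Hom_exact V0 V1 V2 (d0 : {linear V0 -> V1})
    (d1 : {linear V1 -> V2}) :
  (forall x, d1 (d0 x) = 0) ->
  (forall J, injective_module J -> Hom_exact d0 d1 J) -> exact_pair d0 d1.
Proof.
move=> dd hex y; split=> [d1y|[x <-]//].
have [Q [q [q_surj qd0]]] := quotient_projection (range_submodule d0).
have [J [_ [j [_ [J_inj [j_inj _ _]]]]]] := enough_injectives Q.
have [x|g gd] := hex J J_inj (j \o q).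
  by rewrite /= (_ : q (d0 x) = 0) ?linear0 //; apply/qd0; exists x.
apply/qd0; apply: j_inj; rewrite linear0.
by have /= <- := gd y; rewrite d1y linear0.
Qed.

(* The connecting part of the long exact sequence of cohomology of
   0 -> Hom(-, N) -> Hom(-, E) -> Hom(-, N') -> 0; likewise for
   [Hom_exact_quotient]. *)
Lemma Hom_exact_sub_lift V0 V1 V2 V3 (d0 : {linear V0 -> V1})
    (d1 : {linear V1 -> V2}) (d2 : {linear V2 -> V3})
    N E N' (i : {linear N -> E}) (p : {linear E -> N'}) :
  short_exact i p -> (forall x, d2 (d1 x) = 0) ->
  (forall h : {linear V3 -> N'}, exists h' : {linear V3 -> E},
     forall x, p (h' x) = h x) ->
  Hom_exact d0 d1 E -> Hom_exact d1 d2 N' -> Hom_exact d0 d1 N.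
Proof.
move=> [i_inj ip p_surj] dd V3_lift hE hN' f fd0.
have [x|g gd1] := hE (i \o f); first by rewrite /= fd0 linear0.
have [x|h hd2] := hN' (p \o g).
  by rewrite /= gd1; apply/ip; exists (f x).
have [h' h'p] := V3_lift h.
(* Subtracting h' d2 moves [g] into the kernel of [p] and does not change its composite with [d1],
   because d2 d1 = 0. *)
have [k kE] := linear_sub g (h' \o d2).
have [x|l lE] := linear_factor_inj (f := k) i_inj.
  by apply/ip; rewrite kE linearB /= h'p hd2 subrr.
by exists l => x; apply: i_inj; rewrite lE kE gd1 /= dd linear0 subr0.
Qed.

Lemma Hom_exact_sub V0 V1 V2 V3 (d0 : {linear V0 -> V1})
    (d1 : {linear V1 -> V2}) (d2 : {linear V2 -> V3})
    N E N' (i : {linear N -> E}) (p : {linear E -> N'}) :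
  short_exact i p -> projective_module V3 -> (forall x, d2 (d1 x) = 0) ->
  Hom_exact d0 d1 E -> Hom_exact d1 d2 N' -> Hom_exact d0 d1 N.
Proof.
move=> ip V3_proj dd; apply: (Hom_exact_sub_lift ip dd) => h.
by apply: V3_proj; case: ip.
Qed.

Lemma Hom_exact_quotient V0 V1 V2 V3 (d0 : {linear V0 -> V1})
    (d1 : {linear V1 -> V2}) (d2 : {linear V2 -> V3})
    N E N' (i : {linear N -> E}) (p : {linear E -> N'}) :
  short_exact i p -> projective_module V2 -> (forall x, d1 (d0 x) = 0) ->
  Hom_exact d0 d1 N -> Hom_exact d1 d2 E -> Hom_exact d1 d2 N'.
Proof.
move=> [i_inj ip p_surj] V2_proj dd hN hE f fd1.
have [g pg] := V2_proj _ _ p f p_surj.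
have [x|k kE] := linear_factor_inj (f := g \o d1) i_inj.
  by apply/ip; rewrite /= pg fd1.
have [x|h hd1] := hN k.
  by apply: i_inj; rewrite kE /= dd !linear0.
have [l lE] := linear_sub g (i \o h).
have [x|m md2] := hE l; first by rewrite lE /= hd1 kE subrr.
exists (p \o m) => x; rewrite /= md2 lE linearB pg /=.
by rewrite (_ : p (i _) = 0) ?subr0 //; apply/ip; exists (h x).
Qed.

(** A relation, because an n-th cosyzygy depends on the chosen embeddings into injective modules. *)
Fixpoint cosyzygy (n : nat) (M C : lmodType R) : Prop :=
  if n is m.+1 then exists (E M' : lmodType R) (i : {linear M -> E})
      (p : {linear E -> M'}),
    [/\ injective_module E, short_exact i p & cosyzygy m M' C]
  else M = C.

Lemma cosyzygy_exists n M : exists C, cosyzygy n M C.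
Proof.
elim: n M => [|n IHn] M; first by exists M.
have [E [Q [i [p [E_inj ip]]]]] := enough_injectives M.
by have [C QC] := IHn Q; exists C, E, Q, i, p.
Qed.

Lemma cosyzygy_append n M C E C' (i : {linear C -> E}) (p : {linear E -> C'}) :
  cosyzygy n M C -> short_exact i p -> injective_module E ->
  cosyzygy n.+1 M C'.
Proof.
move=> + ip E_inj; elim: n M => [|n IHn] M /=.
  by move=> MC; subst C; exists E, C', i, p.
move=> [F [M' [j [q [F_inj jq M'C]]]]]; exists F, M', j, q; split=> //.
exact: IHn.
Qed.

Section Shift.
Variables (P : nat -> lmodType R) (d : forall i, {linear P i.+1 -> P i}).
Hypothesis P_proj : forall i, projective_module (P i).
Hypothesis d_exact : forall i, exact_pair (d i.+1) (d i).

Let dd i x : d i (d i.+1 x) = 0.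
Proof. by apply/d_exact; exists x. Qed.

(** When [P] resolves a module X, this is dimension shifting: Ext^(n+1)(X, M) vanishes iff Ext^1(X,
    C) does. *)
Lemma Hom_exact_cosyzygy n M C : cosyzygy n M C ->
  Hom_exact (d n.+1) (d n) M <-> Hom_exact (d 1) (d 0) C.
Proof.
elim: n M => [|n IHn] M /=; first by move=> ->.
move=> [E [M' [i [p [E_inj ip /IHn <-]]]]]; split=> h.
  apply: (Hom_exact_quotient ip _ _ h) => //.
  exact: Hom_exact_injective.
apply: (Hom_exact_sub (d2 := d n) ip) => //.
exact: Hom_exact_injective.
Qed.
End Shift.

End HomExact.

(** * Matrices and transposition *)

Section FreeRank.
Variable R : pzRingType.

Definition row_module (n : nat) : lmodType R := ('I_n -> R^o).

Definition lincomb (n : nat) (N : lmodType R) (v : 'I_n -> N)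
  (r : row_module n) : N := \sum_i (r i : R) *: v i.

Lemma lincomb_is_linear n (N : lmodType R) (v : 'I_n -> N) a r s :
  lincomb v (a *: r + s) = a *: lincomb v r + lincomb v s.
Proof.
rewrite /lincomb scaler_sumr -big_split; apply: eq_bigr => i _ /=.
by rewrite !fctE scalerDl scalerA.
Qed.
HB.instance Definition _ n (N : lmodType R) (v : 'I_n -> N) :=
  GRing.isLinear.Build R (row_module n) N _ (lincomb v) (lincomb_is_linear v).

Definition row_basis n (i : 'I_n) : row_module n := fun j => (j == i)%:R.

Lemma lincomb_basis n (N : lmodType R) (v : 'I_n -> N) i : lincomb v (row_basis i) = v i.
Proof.
rewrite /lincomb (bigD1 i) //= /row_basis eqxx scale1r big1 ?addr0 // => j.
by move=> /negbTE ->; rewrite scale0r.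
Qed.

Lemma linear_lincomb n (N : lmodType R) (f : {linear row_module n -> N}) r :
  f r = lincomb (fun i => f (row_basis i)) r.
Proof.
rewrite /lincomb; have {1}-> : r = \sum_i (r i : R) *: row_basis i.
  apply/funext => j; rewrite fct_sumE (bigD1 j) //= big1 => [|i].
    by rewrite addr0 fctE /row_basis eqxx; exact/esym/mulr1.
  by rewrite fctE /row_basis eq_sym => /negbTE ->; exact: mulr0.
by rewrite linear_sum; apply: eq_bigr => i _; rewrite linearZ_LR.
Qed.

Lemma row_module_projective n : projective_module (row_module n).
Proof.
move=> V W p f p_surj.
have /choice[v vP] i : exists x, p x = f (row_basis i) by exact: p_surj.
exists (lincomb v) => r; rewrite (linear_lincomb f) /lincomb linear_sum.
by apply: eq_bigr => i _; rewrite linearZ_LR vP.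
Qed.

(** Elements of free modules are row vectors, on which left linear maps act as right multiplication
    by matrices. *)
Definition rows (a b : nat) (A : 'I_a -> 'I_b -> R) :
    {linear row_module a -> row_module b} :=
  @lincomb a (row_module b) A.

Lemma rows_basis a b (A : 'I_a -> 'I_b -> R) i : rows A (row_basis i) = A i.
Proof. exact: lincomb_basis. Qed.

Definition row_exact a b c (A : 'I_a -> 'I_b -> R) (B : 'I_b -> 'I_c -> R) :
  Prop := exact_pair (rows A) (rows B).

(* Exactness of Hom_R(-, R) of the complex of rows, i.e., of the complex of
   columns [R^c -> R^b -> R^a] of right modules; see [row_exact_transpose]. *)
Definition column_exact a b c (A : 'I_a -> 'I_b -> R) (B : 'I_b -> 'I_c -> R) :
  Prop :=
  (forall x, rows B (rows A x) = 0) /\ Hom_exact (rows A) (rows B) (R^o : lmodType R).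

(** [Q] is a retract of a free module, and a map from R^b to a free module meets only finitely many
    coordinates; on each of them exactness for [R] applies. *)
Lemma Hom_exact_projective a b c (A : 'I_a -> 'I_b -> R) (B : 'I_b -> 'I_c -> R)
    (Q : lmodType R) :
  column_exact A B -> projective_module Q -> Hom_exact (rows A) (rows B) Q.
Proof.
move=> [_ hR] Q_proj.
have [F [e [co [coP Fu]]]] := free_module R Q.
have [p pe] := Fu Q id.
have p_surj y : exists x, p x = y by exists (e y); rewrite pe.
have [s sP] := Q_proj _ _ p (idfun : {linear Q -> Q}) p_surj.
move=> f fA; pose sf : {linear row_module b -> F} := s \o f.
have /choice[r rP] (z : F) := coP z.
(* All generators that occur in the images of the standard basis. *)
pose t := undup (flatten [seq r (sf (row_basis i)) | i <- enum 'I_b]).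
have [h hE] := linear_fun_sum t (fun x => co x \o sf : {linear _ -> R^o}) e.
have hsf y : h y = sf y.
  rewrite linear_lincomb [RHS]linear_lincomb; apply: eq_bigr => i _.
  congr (_ *: _); rewrite hE [RHS](rP _ t) ?undup_uniq // => x xr.
  rewrite mem_undup; apply/flattenP; exists (r (sf (row_basis i))) => //.
  by apply: map_f; rewrite mem_enum.
have /choice[g gP] x : exists g : {linear row_module c -> (R^o : lmodType R)},
    forall y, g (rows B y) = co x (sf y).
  by apply: (hR (co x \o sf)) => y; rewrite /= fA !linear0.
have [k kE] := linear_fun_sum t g e.
exists (p \o k) => y; rewrite /= kE.
under eq_bigr => x _ do rewrite gP.
by have := hE y; rewrite hsf /= => <-; rewrite sP.
Qed.
End FreeRank.

Section Transpose.
Variables (R S : pzRingType) (s : R -> S) (t : S -> R).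

(** Presenting the opposite ring by a pair of inverse maps keeps [R] and [S] symmetric: each result
    applies to R and R^c in either order. *)
Definition anti_isomorphism : Prop :=
  [/\ cancel s t, cancel t s, {morph s : x y / x + y}
    & forall x y, s (x * y) = s y * s x].

Definition transpose a b (A : 'I_a -> 'I_b -> R) : 'I_b -> 'I_a -> S :=
  fun j i => s (A i j).

Hypothesis st : anti_isomorphism.

Let sK : cancel s t. Proof. by case: st. Qed.
Let tK : cancel t s. Proof. by case: st. Qed.
Let sD : {morph s : x y / x + y}. Proof. by case: st. Qed.
Let sM x y : s (x * y) = s y * s x. Proof. by case: st. Qed.
Let s0 : s 0 = 0. Proof. by apply: (addrI (s 0)); rewrite -sD !addr0. Qed.

(** A linear form on R^b is encoded by its values on the basis, moved to [S]; composing it with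
    [rows A] is then multiplication by the transpose. *)
Lemma rows_transpose a b (A : 'I_a -> 'I_b -> R)
    (f : {linear row_module R b -> (R^o : lmodType R)}) i :
  rows (transpose A) (fun j => s (f (row_basis R j))) i = s (f (A i)).
Proof.
rewrite (linear_lincomb f) /rows /= /lincomb fct_sumE (big_morph s sD s0).
by apply: eq_bigr => j _; rewrite fctE sM.
Qed.

Lemma rows_transpose_comp a b c (A : 'I_a -> 'I_b -> R) (B : 'I_b -> 'I_c -> R)
    (f : {linear row_module R c -> (R^o : lmodType R)}) :
  rows (transpose A) (rows (transpose B) (fun k => s (f (row_basis R k)))) =
  fun i => s (f (rows B (A i))).
Proof.
have -> : rows (transpose B) (fun k => s (f (row_basis R k))) =
    fun j => s ((f \o rows B) (row_basis R j)).
  by apply/funext => j; rewrite rows_transpose /= rows_basis.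
by apply/funext => i; exact: rows_transpose.
Qed.

(** In the coordinates of [rows_transpose], Hom_R(-, R) of the complex of rows is the transposed
    complex over [S]. *)
Lemma row_exact_transpose a b c (A : 'I_a -> 'I_b -> R) (B : 'I_b -> 'I_c -> R) :
  row_exact (transpose B) (transpose A) <-> column_exact A B.
Proof.
have coords n (y : row_module S n) :
    exists f : {linear row_module R n -> (R^o : lmodType R)},
      y = fun i => s (f (row_basis R i)).
  exists (lincomb (fun i => t (y i) : R^o)); apply/funext => i.
  rewrite -[LHS]tK; congr s; exact/esym/(@lincomb_basis R n R^o).
have s_eq0 x : s x = 0 -> x = 0 by rewrite -s0 => /(can_inj sK).
have f_eq0 n m (D : 'I_n -> 'I_m -> R)
    (f : {linear row_module R m -> (R^o : lmodType R)}) :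
    rows (transpose D) (fun j => s (f (row_basis R j))) = 0 <->
    forall x, f (rows D x) = 0.
  split=> [D0 x|f0].
    rewrite [LHS](linear_lincomb (f \o rows D)) /lincomb big1 // => i _ /=.
    rewrite rows_basis (s_eq0 (f (D i))); first exact: mulr0.
    by rewrite -rows_transpose D0.
  by apply/funext => i; rewrite rows_transpose -rows_basis f0.
split=> [ex|[dd hex] y]; [split=> [x|f fA]|split=> [Ay|[x <-]]].
- apply/funext => k.
  have [a' u v|f fE] := @linear_of_fun R (row_module R c) R^o (fun r => r k).
    by [].
  rewrite -fE; apply: (proj1 (f_eq0 _ _ A (f \o rows B))).
  apply/ex; exists (fun k => s (f (row_basis R k))); apply/funext => j.
  by rewrite rows_transpose /= rows_basis.
- have /ex[y yE] := proj2 (f_eq0 _ _ A f) fA.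
  have [g gE] := coords _ y; exists g => x.
  rewrite [LHS](linear_lincomb (g \o rows B)) [RHS]linear_lincomb.
  apply: eq_bigr => j _; congr (_ *: _) => /=; apply: (can_inj sK).
  by rewrite rows_basis -rows_transpose -gE yE.
- have [f fE] := coords _ y; rewrite fE in Ay *.
  have [g gE] := hex f (proj1 (f_eq0 _ _ A f) Ay).
  exists (fun k => s (g (row_basis R k))); apply/funext => j.
  by rewrite rows_transpose -rows_basis gE.
- have [f ->] := coords _ x; rewrite rows_transpose_comp; apply/funext => i.
  by rewrite -rows_basis dd linear0 s0.
Qed.
End Transpose.

Lemma anti_isomorphism_sym (R S : pzRingType) (s : R -> S) (t : S -> R) :
  anti_isomorphism s t -> anti_isomorphism t s.
Proof.
move=> [sK tK sD sM]; split=> // x y; apply: (can_inj sK).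
  by rewrite sD !tK.
by rewrite sM !tK.
Qed.

Lemma transposeK (R S : pzRingType) (s : R -> S) (t : S -> R) a b
    (A : 'I_a -> 'I_b -> R) :
  cancel s t -> transpose t (transpose s A) = A.
Proof. by move=> sK; apply/funext => i; apply/funext => j; exact: sK. Qed.

(** * Noetherian modules *)

Section FinitelyGenerated.
Variable R : pzRingType.
Implicit Types V W K : lmodType R.

Fixpoint span V (s : seq V) : set V :=
  if s is x :: s' then fun y => exists (a : R) z, span s' z /\ y = a *: x + z
  else fun y => y = 0.

Lemma span_submodule V (s : seq V) : submodule_set (span s).
Proof.
elim: s => [|x s [IH0 IHD]] /=; first by split=> // a u v -> ->; rewrite scaler0 addr0.
split=> [|a _ _ [b [u [su ->]]] [c [v [sv ->]]]].
  by exists 0, 0; rewrite scale0r addr0.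
exists (a * b + c), (a *: u + v); split; first exact: IHD.
by rewrite scalerDr scalerDl scalerA addrACA.
Qed.

Lemma span_min V (s : seq V) (N : set V) : submodule_set N ->
  (forall x, x \in s -> N x) -> forall y, span s y -> N y.
Proof.
move=> N_sub; elim: s => [|x s IHs] sN y /=; first by move=> ->; exact: N_sub.1.
move=> [a [z [sz ->]]]; apply: N_sub.2; first by apply: sN; rewrite inE eqxx.
by apply: IHs sz => u us; apply: sN; rewrite inE us orbT.
Qed.

Lemma mem_span V (s : seq V) x : x \in s -> span s x.
Proof.
elim: s => // y s IHs; rewrite inE => /orP[/eqP ->|/IHs sx].
  by exists 1, 0; rewrite scale1r addr0; split=> //; exact: (span_submodule s).1.
by exists 0, x; rewrite scale0r add0r.
Qed.

Lemma span_lincomb V (s : seq V) y :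
  span s y <-> exists r, lincomb (fun i : 'I_(size s) => nth 0 s i) r = y.
Proof.
split.
  elim: s y => [|x s IHs] y /=.
    by move=> ->; exists 0; rewrite linear0.
  move=> [a [z [/IHs[r <-] ->]]].
  exists (fun i => if unlift ord0 i is Some j then r j else a).
  rewrite /lincomb big_ord_recl unlift_none; congr (_ + _).
  by apply: eq_bigr => i _; rewrite liftK.
move=> [r <-]; rewrite /lincomb.
have [S0 SD] := span_submodule s.
elim/big_ind: _ => // [u v Su Sv|i _]; first by rewrite -[u]scale1r; exact: SD.
by rewrite -[_ *: _]addr0; apply: SD => //; apply: mem_span; exact: mem_nth.
Qed.

Definition fg_submodules V : Prop :=
  forall N : set V, submodule_set N -> exists s : seq V, forall y, N y <-> span s y.

(** Otherwise adjoining, again and again, an element of [N] outside the span of the previous ones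
    gives a strictly increasing chain. *)
Lemma noetherian_fg V : noetherian_module V -> fg_submodules V.
Proof.
move=> Vnoeth N N_sub; apply: contrapT => nfg.
have /choice[next nextP] (s : seq V) : exists x, (forall y, y \in s -> N y) ->
    N x /\ ~ span s x.
  have [sN|nsN] := pselect (forall y, y \in s -> N y); last by exists 0.
  apply: contrapT => nx; apply: nfg; exists s => y; split; last exact: span_min.
  by move=> Ny; apply: contrapT => nsy; apply: nx; exists y.
pose seqs k := iter k (fun s => next s :: s) [::].
have seqsN k x : x \in seqs k -> N x.
  elim: k x => //= k IHk x; rewrite inE => /orP[/eqP ->|]; last exact: IHk.
  by case: (nextP (seqs k) IHk).
have [k|k x Sx|n nP] := Vnoeth (fun k => span (seqs k)).
- have [S0 SD] := span_submodule (seqs k).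
  split=> [|a u v]; rewrite !inE //; exact: SD.
- by exists 0, x; rewrite scale0r add0r.
have [_] := nextP (seqs n) (@seqsN n); apply.
rewrite -(nP n.+1 (leqnSn n)); apply: mem_span; exact: mem_head.
Qed.

(** Generators of the preimage of [N] in [K], together with lifts of generators of the image of [N]
    in [W], generate [N]. *)
Lemma fg_submodules_ext K V W (i : {linear K -> V}) (p : {linear V -> W}) :
  exact_pair i p -> fg_submodules K -> fg_submodules W -> fg_submodules V.
Proof.
move=> ip Kfg Wfg N N_sub.
have [|s sP] := Kfg (fun x => N (i x)).
  by split=> [|a u v Nu Nv]; rewrite /= ?linear0 ?linearP; [exact: N_sub.1 | exact: N_sub.2].
have [|t tP] := Wfg (fun z => exists2 y, N y & p y = z).
  split=> [|a _ _ [u Nu <-] [v Nv <-]]; first by exists 0; rewrite ?linear0 //; exact: N_sub.1.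
  by exists (a *: u + v); rewrite ?linearP //; exact: N_sub.2.
have /choice[l lP] z : exists y, z \in t -> N y /\ p y = z.
  have [zt|] := boolP (z \in t); last by exists 0.
  by have /tP[y Ny yz] := mem_span zt; exists y.
pose r := map i s ++ map l t; exists r => y; split; last first.
  apply: span_min => // x; rewrite mem_cat => /orP[] /mapP[z zs ->].
    by apply/sP; exact: mem_span.
  by case: (lP z zs).
have span_r : submodule_set (span r) := span_submodule r.
have lift z : span t z -> exists2 y', span r y' & p y' = z.
  have pr_sub : submodule_set (fun z => exists2 y', span r y' & p y' = z).
    split=> [|a _ _ [u Nu <-] [v Nv <-]]; first by exists 0; rewrite ?linear0 //; exact: span_r.1.
    by exists (a *: u + v); rewrite ?linearP //; exact: span_r.2.
  apply: (span_min pr_sub) => x xt; exists (l x); last by case: (lP x xt).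
  by apply: mem_span; rewrite mem_cat map_f ?orbT.
have rN x : span r x -> N x.
  apply: span_min => // {}x; rewrite mem_cat => /orP[] /mapP[z zs ->].
    by apply/sP; exact: mem_span.
  by case: (lP z zs).
move=> Ny; have /lift[y' ry' py'] : span t (p y) by apply/tP; exists y.
have [x xE] : exists x, i x = y - y' by apply/ip; rewrite linearB py' subrr.
rewrite -(subrK y' y) -xE; apply: (submodule_setD span_r _ (ry')).
have : span s x.
  by apply/sP; rewrite /= xE; apply: (submodule_setB N_sub Ny); exact: rN.
have ir_sub : submodule_set (fun x => span r (i x)).
  by split=> [|a u v ru rv]; rewrite /= ?linear0 ?linearP; [exact: span_r.1 | exact: span_r.2].
apply: (span_min ir_sub) => z zs.
by apply: mem_span; rewrite mem_cat map_f.
Qed.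

(** Induction on [n] along 0 -> R^n -> R^(n+1) -> R -> 0, the last map being coordinate 0. *)
Lemma row_module_fg n : left_noetherian R -> fg_submodules (row_module R n).
Proof.
move=> /noetherian_fg Rfg; elim: n => [|n IHn].
  move=> N [N0 _]; exists [::] => y /=.
  have -> : y = 0 by apply/funext; case.
  by split.
have [a u v|i iE] := @linear_of_fun R (row_module R n) (row_module R n.+1)
    (fun r j => if unlift ord0 j is Some k then r k else 0).
  apply/funext => j; rewrite !fctE; case: unlift => //.
  by rewrite scaler0 addr0.
have [a u v|p pE] := @linear_of_fun R (row_module R n.+1) R^o (fun r => r ord0).
  by [].
apply: (fg_submodules_ext (i := i) (p := p)) => // y; split=> [|[x <-]].
  rewrite pE => y0; exists (fun k => y (lift ord0 k)); rewrite iE.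
  by apply/funext => j; case: unliftP => [k|] ->.
by rewrite pE iE unlift_none.
Qed.

Lemma noetherian_rows n (N : set (row_module R n)) :
  left_noetherian R -> submodule_set N ->
  exists m (D : 'I_m -> 'I_n -> R), forall y, N y <-> exists r, rows D r = y.
Proof.
move=> Rn N_sub; have [s sP] := row_module_fg Rn N_sub.
exists (size s), (fun i => nth 0 s i) => y; rewrite sP; exact: span_lincomb.
Qed.

Lemma noetherian_row_exact a b (B : 'I_a -> 'I_b -> R) : left_noetherian R ->
  exists m (D : 'I_m -> 'I_a -> R), row_exact D B.
Proof.
move=> Rn; have [|m [D DP]] := @noetherian_rows a (fun x => rows B x = 0) Rn.
  by split=> [|c u v Bu Bv]; rewrite ?linear0 // linearP Bu Bv scaler0 addr0.
by exists m, D => y; exact: DP.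
Qed.

(** A resolution of R / I by finitely generated free modules; its term R^1 in degree 0 is identified
    with R by [e]. *)
Lemma noetherian_resolution (I : set (R^o : lmodType R)) :
  left_noetherian R -> submodule_set I ->
  exists (k : nat -> nat) (D : forall i, 'I_(k i.+1) -> 'I_(k i) -> R)
      (e : {linear row_module R (k 0%N) -> (R^o : lmodType R)}),
    [/\ forall i, row_exact (D i.+1) (D i), bijective e
      & forall y, I y <-> exists r, e (rows (D 0%N) r) = y].
Proof.
move=> Rn I_sub.
have [a u v|e eE] := @linear_of_fun R (row_module R 1) R^o (fun r => r ord0).
  by [].
have [|k1 [D0 D0P]] := @noetherian_rows 1 (fun r => I (e r)) Rn.
  by split=> [|a u v Iu Iv]; rewrite /= ?linear0 ?linearP; [exact: I_sub.1 | exact: I_sub.2].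
(* A state is a matrix together with its two sizes; [step] replaces it by a matrix whose rows
   generate its kernel. *)
pose st := {a : nat & {b : nat & 'I_a -> 'I_b -> R}}.
have next_ex (x : st) : {y : {m : nat & 'I_m -> 'I_(projT1 x) -> R} |
    row_exact (projT2 y) (projT2 (projT2 x))}.
  apply: cid; have [m [D ex]] := noetherian_row_exact (projT2 (projT2 x)) Rn.
  by exists (existT _ m D).
pose next x := sval (next_ex x).
pose step (x : st) : st :=
  existT _ (projT1 (next x)) (existT _ (projT1 x) (projT2 (next x))).
pose X n : st := iter n step (existT _ k1 (existT _ 1%N D0)).
pose k n := if n is m.+1 then projT1 (X m) else 1%N.
pose D n : 'I_(k n.+1) -> 'I_(k n) -> R :=
  if n is m.+1 return 'I_(k n.+1) -> 'I_(k n) -> R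
  then projT2 (next (X m)) else D0.
exists k, D, e; split=> [[|i]||y].
- exact: (svalP (next_ex (X 0%N))).
- exact: (svalP (next_ex (X i.+1))).
- exists (fun r _ => r) => x; first by apply/funext => j; rewrite eE (ord1 j).
  by rewrite eE.
split=> [Iy|[r <-]]; last by apply/D0P; exists r.
have /D0P[r rE] : I (e (fun _ => y)) by rewrite eE.
by exists r; rewrite [rows _ _]rE eE.
Qed.
End FinitelyGenerated.

(** * Acyclicity of tensor products *)

(** The hypothesis gives Ext^(n+1)(R / I, L) = 0 for every left ideal I, hence Ext^1(R / I, C) = 0
    by dimension shifting, which is Baer's condition for [C]. *)
Lemma cosyzygy_injective (R : pzRingType) n (L C : lmodType R) :
  left_noetherian R -> cosyzygy n L C ->
  (forall (k : nat -> nat) (D : forall i, 'I_(k i.+1) -> 'I_(k i) -> R),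
     (forall i, row_exact (D i.+1) (D i)) ->
     Hom_exact (rows (D n.+1)) (rows (D n)) L) ->
  injective_module C.
Proof.
move=> Rn LC hL; apply: Baer_criterion => I phi I_sub phiP.
have [k [D [e [D_ex [e' e'K eK] IP]]]] := noetherian_resolution Rn I_sub.
have phi0 : phi 0 = 0.
  by have := phiP (-1) 0 0 I_sub.1 I_sub.1; rewrite mulr0 addr0 scaleN1r addNr.
have ID r : I (e (rows (D 0%N) r)) by apply/IP; exists r.
have [a u v|f fE] := @linear_of_fun R (row_module R (k 1%N)) C
    (fun r => phi (e (rows (D 0%N) r))).
  by rewrite -phiP // linearP linearP.
have := hL k D D_ex.
move=> /(Hom_exact_cosyzygy (fun i => @row_module_projective R (k i)) D_ex LC).
case/(_ f) => [x|g gE].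
  by rewrite fE (_ : rows (D 0%N) _ = 0) ?linear0 //; apply/D_ex; exists x.
(* [g] extends [phi] from I to R^1, so the required element is its value at the vector corresponding
   to 1. *)
exists (g (e' 1)) => _ /IP[x <-]; rewrite -fE -gE -linearZ_LR; congr (g _).
apply: (can_inj e'K); rewrite linearZ_LR eK; exact/esym/mulr1.
Qed.

(** Induction on the injective dimension of [N]; each step moves one degree to the right in [V], so
    [V] has to go on indefinitely. *)
Lemma Hom_exact_finite_dim (R : pzRingType) n (N C : lmodType R)
    (V : nat -> lmodType R) (d : forall i, {linear V i -> V i.+1}) :
  (forall i, projective_module (V i)) ->
  (forall i, exact_pair (d i) (d i.+1)) ->
  cosyzygy n N C -> injective_module C -> Hom_exact (d 0%N) (d 1%N) N.
Proof.
elim: n N V d => [|n IHn] N V d V_proj d_ex /= NC C_inj.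
  by rewrite NC; exact: Hom_exact_injective.
case: NC => E [N' [i [p [E_inj ip N'C]]]].
apply: (Hom_exact_sub (d2 := d 2%N) ip) => //.
- by move=> x; apply/d_ex; exists x.
- exact: Hom_exact_injective.
- exact: (IHn N' (fun i => V i.+1) (fun i => d i.+1)).
Qed.

(* The complexes of columns are the complexes [T] of finitely generated free
   right modules, exact in degrees >= 1, and [Hom_R(rows, L)] is [T (x)_R L]. *)
Definition tensor_acyclic (R : pzRingType) (L : lmodType R) : Prop :=
  forall (k : nat -> nat) (B : forall i, 'I_(k i.+1) -> 'I_(k i) -> R),
    (forall i, column_exact (B i.+1) (B i)) ->
    Hom_exact (rows (B 1%N)) (rows (B 0%N)) L.

Lemma tensor_acyclic_projective (R : pzRingType) (P : lmodType R) :
  projective_module P -> tensor_acyclic P.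
Proof. by move=> P_proj k B B_ex; exact: Hom_exact_projective. Qed.

Section TensorAcyclic.
Variables (R S : pzRingType) (s : R -> S) (t : S -> R).
Hypothesis st : anti_isomorphism s t.

(** The complex of rows is the dual Hom_S(T, S) of T, hence exact because S has finite injective
    dimension, and Hom(-, J) preserves this exactness. *)
Lemma tensor_acyclic_injective m (C : lmodType S) (J : lmodType R) :
  cosyzygy m (S^o : lmodType S) C -> injective_module C ->
  injective_module J -> tensor_acyclic J.
Proof.
move=> SC C_inj J_inj k B B_ex; apply: Hom_exact_injective J_inj.
have T_ex i : row_exact (transpose s (B i)) (transpose s (B i.+1)).
  exact/(row_exact_transpose st).
have [sK _ _ _] := st.
rewrite -[B 1%N](transposeK _ sK) -[B 0%N](transposeK _ sK).
apply/(row_exact_transpose (anti_isomorphism_sym st)).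
split=> [x|]; first by apply/T_ex; exists x.
apply: (Hom_exact_finite_dim (V := fun i => row_module S (k i))
  (d := fun i => rows (transpose s (B i))) _ T_ex SC C_inj) => i.
exact: row_module_projective.
Qed.

(* The kernel of [T^1 -> T^2] is finitely generated, so that [T] extends by one
   degree to the left; exactness for [M] in degree 0 of the extension then gives
   exactness for [K] in degree 1. *)
Lemma tensor_acyclic_kernel (K P M : lmodType R) (i : {linear K -> P})
    (p : {linear P -> M}) :
  left_noetherian S -> short_exact i p -> projective_module P ->
  tensor_acyclic M -> tensor_acyclic K.
Proof.
move=> Sn ip P_proj M_ac k B B_ex.
have [m [D D_ex]] := noetherian_row_exact (transpose s (B 0%N)) Sn.
have [_ tK _ _] := st; rewrite -(transposeK D tK) in D_ex.
move/(row_exact_transpose st): D_ex; set B' := transpose t D => B'_ex.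
have hM : Hom_exact (rows (B 0%N)) (rows B') M.
  apply: (M_ac (fun i => if i is j.+1 then k j else m)
    (fun i => match i with 0 => B' | j.+1 => B j end)).
  by case.
apply: (Hom_exact_sub ip _ _ _ hM) => //.
- exact: row_module_projective.
- exact: B'_ex.1.
- exact: Hom_exact_projective.
Qed.
End TensorAcyclic.

(** As [R] has injective dimension at most n, a free resolution of R / I stays exact under Hom(-, R)
    in degrees > n. Its part from degree n on is thus a test complex for [L], and yields Ext^(n+1)(R
    / I, L) = 0. *)
Lemma tensor_acyclic_cosyzygy (R : pzRingType) n (CR L C : lmodType R) :
  left_noetherian R ->
  cosyzygy n (R^o : lmodType R) CR -> injective_module CR ->
  tensor_acyclic L -> cosyzygy n L C -> injective_module C.
Proof.
move=> Rn RC CR_inj L_ac LC; apply: (cosyzygy_injective Rn LC) => k D D_ex.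
(* The index [i + n] has [i] first, so that [i.+1 + n] computes to a successor and the matrix sizes
   match. *)
apply: (L_ac (fun i => k (i + n)%N) (fun i => D (i + n)%N)) => i.
split=> [x|]; first by apply/D_ex; exists x.
elim: i k D D_ex => [|i IHi] k D D_ex; last first.
  exact: (IHi (fun i => k i.+1) (fun i => D i.+1)).
apply/(Hom_exact_cosyzygy (fun i => @row_module_projective R (k i)) D_ex RC).
exact: (Hom_exact_injective (D_ex 0%N)) CR_inj.
Qed.

(** * Syzygies *)

(** The resolution is stored through its syzygies [Om j]; its differentials are the composites
    [i j \o p j.+1]. *)
Lemma projective_resolution (R : pzRingType) (J : lmodType R) :
  exists (Om Q : nat -> lmodType R) (i : forall j, {linear Om j.+1 -> Q j})
      (p : forall j, {linear Q j -> Om j}),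
    [/\ Om 0%N = J, forall j, projective_module (Q j)
      & forall j, short_exact (i j) (p j)].
Proof.
have [K /choice[P KP]] := choice (@enough_projectives R).
pose Om n := iter n K J.
have i_ex j := cid (KP (Om j)); have p_ex j := cid (svalP (i_ex j)).
exists Om, (fun j => P (Om j)), (fun j => sval (i_ex j)), (fun j => sval (p_ex j)).
by split=> // j; case: (svalP (p_ex j)).
Qed.

Section Resolution.
Variables (R : pzRingType) (Om Q : nat -> lmodType R).
Variables (i : forall j, {linear Om j.+1 -> Q j}) (p : forall j, {linear Q j -> Om j}).
Hypothesis Q_proj : forall j, projective_module (Q j).
Hypothesis ip : forall j, short_exact (i j) (p j).

Let d j : {linear Q j.+1 -> Q j} := i j \o p j.+1.

Lemma resolution_exact j : exact_pair (d j.+1) (d j).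
Proof.
move=> y /=; have [i_inj _ _] := ip j; have [_ ker_p _] := ip j.+1.
have [_ _ p_surj] := ip j.+2.
split=> [|[x <-]].
  rewrite -[RHS](linear0 (i j)) => /i_inj /ker_p[z <-].
  by have [x <-] := p_surj z; exists x.
by rewrite (_ : p _ _ = 0) ?linear0 //; apply/ker_p; exists (p j.+2 x).
Qed.

Lemma resolution_factor j (M : lmodType R) (f : {linear Q j.+1 -> M}) :
  (forall x, f (d j.+1 x) = 0) ->
  exists g : {linear Om j.+1 -> M}, forall x, g (p j.+1 x) = f x.
Proof.
move=> fd; have [_ ker_p p_surj] := ip j.+1.
apply: linear_factor_surj => // x /ker_p[z <-].
by have [_ _ /(_ z)[y <-]] := ip j.+2; exact: fd.
Qed.

(** With J for [Om 0], Ext^1(J, Y) = 0 is the obstruction to lifting maps from J along [v]. *)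
Lemma lift_of_Hom_exact (Y V W : lmodType R) (u : {linear Y -> V})
    (v : {linear V -> W}) (f : {linear Om 0%N -> W}) :
  Hom_exact (d 1) (d 0) Y -> short_exact u v ->
  exists g : {linear Om 0%N -> V}, forall x, v (g x) = f x.
Proof.
move=> hY [u_inj uv v_surj].
have [_ ip0 p0_surj] := ip 0; have [_ _ p1_surj] := ip 1.
have [g gE] := Q_proj (f \o p 0%N) v_surj.
have [z|k kE] := linear_factor_inj (f := g \o i 0%N) u_inj.
  apply/uv; rewrite /= gE /= (_ : p 0%N _ = 0) ?linear0 //.
  by apply/ip0; exists z.
have [x|h hE] := hY (k \o p 1%N).
  rewrite /= (_ : p 1%N _ = 0) ?linear0 //; have [_ ker_p _] := ip 1.
  by apply/ker_p; exists (p 2%N x).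
have hi z : h (i 0%N z) = k z.
  by have [x <-] := p1_surj z; exact: hE.
have [l lE] := linear_sub g (u \o h).
have [x /ip0[z <-]|m mE] := linear_factor_surj (f := l) p0_surj.
  by rewrite lE /= hi kE subrr.
exists m => y; have [x <-] := p0_surj y; rewrite mE lE linearB gE /=.
by rewrite (_ : v (u _) = 0) ?subr0 //; apply/uv; exists (h x).
Qed.

(** For injective [E], Ext^1(J, Y) is the cokernel of Hom(J, E) -> Hom(J, Y'). *)
Lemma Hom_exact_of_lift (Y E Y' : lmodType R) (u : {linear Y -> E})
    (v : {linear E -> Y'}) :
  short_exact u v -> injective_module E ->
  (forall f : {linear Om 0%N -> Y'}, exists g : {linear Om 0%N -> E},
     forall x, v (g x) = f x) ->
  Hom_exact (d 1) (d 0) Y.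
Proof.
move=> uv E_inj lift; have [_ ip0 p0_surj] := ip 0%N.
apply: (Hom_exact_sub_lift (d2 := p 0%N) uv) => [x||f fd|f fd] //.
- by apply/ip0; exists (p 1%N x).
- exact: (Hom_exact_injective (@resolution_exact 0)).
- apply: linear_factor_surj => // x /ip0[z <-].
  by have [_ _ /(_ z)[y <-]] := ip 1; exact: fd.
Qed.

(** The vanishing of Ext^(n+1)(J, Om n.+1) is applied to the class of the surjection [p n.+1]. *)
Lemma syzygy_retraction n : Hom_exact (d n.+1) (d n) (Om n.+1) ->
  exists r : {linear Q n -> Om n.+1}, cancel (i n) r.
Proof.
have [_ ip1 p1_surj] := ip n.+1; move=> /(_ (p n.+1))[x|r rE].
  by apply/ip1; exists (p n.+2 x).
by exists r => z; have [x <-] := p1_surj z; exact: rE.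
Qed.

(** The retraction splits [Q n], so that [Om n] is a direct summand of it. *)
Lemma syzygy_projective n :
  Hom_exact (d n.+1) (d n) (Om n.+1) -> projective_module (Om n).
Proof.
move=> /syzygy_retraction[r ri] V W q f q_surj.
have [_ ipn pn_surj] := ip n.
have [g gE] := linear_sub (idfun : {linear Q n -> Q n}) (i n \o r).
have [x /ipn[z <-]|s sE] := linear_factor_surj (f := g) pn_surj.
  by rewrite gE /= ri subrr.
have [h hE] := Q_proj (f \o p n) q_surj.
exists (h \o s) => y; rewrite /= hE /=; congr (f _).
have [x <-] := pn_surj y; rewrite sE gE linearB /=.
by rewrite (_ : p n (i n _) = 0) ?subr0 //; apply/ipn; exists (r x).
Qed.

(** Composing with the retraction extends every map from [Om n.+1] to [Q n]; so one coefficient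
    module decides the vanishing of Ext^(n+1)(J, -). *)
Lemma Hom_exact_syzygy n (M : lmodType R) :
  Hom_exact (d n.+1) (d n) (Om n.+1) -> Hom_exact (d n.+1) (d n) M.
Proof.
move=> /syzygy_retraction[r ri] f fd; have [g gE] := resolution_factor fd.
by exists (g \o r) => x; rewrite /= ri gE.
Qed.
End Resolution.

(** * Gorenstein injective dimension *)

Lemma exact_atP (R : pzRingType) (A B C : lmodType R) (f : {linear A -> B})
    (g : {linear B -> C}) : exact_at f g <-> exact_pair f g.
Proof.
split=> [fg y|fg].
  have -> : (g y = 0) = kernel g y by [].
  by rewrite -fg; split=> -[x]; [exists x | exists x].
apply/seteqP; split=> y; first by move=> [x _ <-]; apply/fg; exists x.
by move=> /fg[x <-]; exists x.
Qed.

Section Dimension.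
Variable R : pzRingType.
Implicit Types (P : lmodType R -> Prop) (M N : lmodType R).

Definition iso_closed P : Prop := forall M N (f : {linear M -> N}),
  injective f -> (forall y, exists x, f x = y) -> P N -> P M.

(** The recursive counterpart of [has_coresolution], suited to induction on the length. *)
Fixpoint dim_le P (m : nat) M : Prop :=
  if m is l.+1 then exists (G M' : lmodType R) (i : {linear M -> G})
      (p : {linear G -> M'}), [/\ P G, short_exact i p & dim_le P l M']
  else P M.

Lemma dim_le_of_has_coresolution P m M : iso_closed P ->
  has_coresolution P M m -> dim_le P m M.
Proof.
move=> P_iso; elim: m M => [|m IHm] M.
  move=> [G [eta [d [PG G0 eta_inj /exact_atP eta_d _]]]].
  apply: (P_iso _ _ eta) (PG 0%N (leqnn 0)) => // y.
  by apply/eta_d; exact: G0.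
move=> [G [eta [d [PG G0 eta_inj /exact_atP eta_d d_ex]]]].
(* The kernel of [d 1] is the image of [d 0], hence a cokernel of [eta]. *)
have [|K [k [k_inj kK]]] := @submodule_inclusion R (G 1%N) (fun x => d 1%N x = 0).
  by split=> [|a u v du dv]; rewrite ?linear0 // linearP du dv scaler0 addr0.
have d01 := proj1 (exact_atP _ _) (d_ex 0%N).
have [x|q qE] := linear_factor_inj (f := d 0%N) k_inj.
  by apply/kK/d01; exists x.
exists (G 0%N), K, eta, q; split; first exact: PG.
  split=> // y.
    rewrite -eta_d -qE; split=> [->|]; first by rewrite linear0.
    by rewrite -[RHS](linear0 k) => /k_inj.
  have /kK/d01[x xE] : exists y', k y' = k y by exists y.
  by exists x; apply: k_inj; rewrite qE.
apply: IHm; exists (fun i => G i.+1), k, (fun i => d i.+1); split=> //.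
- by move=> i im; exact: PG.
- by move=> i im; exact: G0.
- by apply/exact_atP.
Qed.

Lemma has_coresolution_of_dim_le P m M : dim_le P m M -> has_coresolution P M m.
Proof.
elim: m M => [|m IHm] M /=.
  (* [row_module R 0] serves as the zero module. *)
  move=> PM; pose G n : lmodType R := if n is _.+1 then row_module R 0 else M.
  have G0 n (x : G n.+1) : x = 0 by apply/funext; case.
  exists G, (idfun : {linear M -> M}), (fun i => (\0 : {linear G i -> G i.+1})).
  split=> [[|i] //|[|i] // _|//||i]; apply/exact_atP => y.
    by split=> // _; exists y.
  by rewrite (G0 _ y); split=> // _; exists 0.
move=> [G [M' [i [p [PG [i_inj ip p_surj] /IHm]]]]].
move=> [H [eta [d [PH H0 eta_inj /exact_atP eta_d d_ex]]]].
pose G' n := if n is l.+1 then H l else G.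
exists G', i, (fun n => if n is l.+1 return {linear G' n -> G' n.+1} then d l
  else eta \o p); split=> //.
- by case.
- by case.
- apply/exact_atP => y; rewrite -ip /=; split=> [|->]; last exact: linear0.
  by rewrite -[RHS](linear0 eta) => /eta_inj.
case=> [|l]; last exact: d_ex.
apply/exact_atP => y; rewrite eta_d; split=> [[x <-]|[x <-]].
  by have [z <-] := p_surj x; exists z.
by exists (p x).
Qed.

Lemma injective_iso_closed : iso_closed (@injective_module R).
Proof.
move=> M N f f_inj f_surj N_inj A B i g i_inj.
have [h hE] := injective_extension (f \o g) N_inj i_inj.
have [x|k kE] := linear_factor_inj (f := h) f_inj; first exact: f_surj.
by exists k => a; apply: f_inj; rewrite /= kE hE.
Qed.

Lemma zero_injective : injective_module (row_module R 0).
Proof.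
move=> A B i g i_inj; exists (\0 : {linear B -> row_module R 0}) => a.
by apply/funext; case.
Qed.

Lemma dim_le_injectiveS m M :
  dim_le (@injective_module R) m M -> dim_le (@injective_module R) m.+1 M.
Proof.
elim: m M => [|m IHm] M.
  move=> M_inj; exists M, (row_module R 0), (idfun : {linear M -> M}), \0.
  split=> //; last exact: zero_injective.
  split=> [//|y|z]; first by split=> // _; exists y.
  by exists 0; apply/funext; case.
by move=> [G [M' [i [p [PG ip /IHm]]]]]; exists G, M', i, p.
Qed.

(** A coresolution of length at most [n] is padded with zero modules to length exactly [n]; its last
    term is then an n-th cosyzygy. *)
Lemma injective_dim_leP n M : injective_dim_le M n <->
  exists2 C, cosyzygy n M C & injective_module C.
Proof.
have dimP m N : dim_le (@injective_module R) m N <->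
    exists2 C, cosyzygy m N C & injective_module C.
  elim: m N => [|m IHm] N /=.
    by split=> [|[C ->]]; [exists N | ].
  split=> [[G [N' [i [p [G_inj ip /IHm[C N'C C_inj]]]]]]|].
    by exists C => //; exists G, N', i, p.
  move=> [C [G [N' [i [p [G_inj ip N'C]]]]] C_inj].
  by exists G, N', i, p; split=> //; apply/IHm; exists C.
split=> [[m mn /(dim_le_of_has_coresolution injective_iso_closed) Mm]|].
  apply/dimP; rewrite -(subnK mn); elim: (n - m)%N => [//|l IHl].
  exact: dim_le_injectiveS.
by move=> /dimP/has_coresolution_of_dim_le; exists n.
Qed.
End Dimension.

Lemma Hom_exact_retract (R : pzRingType) (V0 V1 V2 N X : lmodType R)
    (d0 : {linear V0 -> V1}) (d1 : {linear V1 -> V2})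
    (a : {linear N -> X}) (b : {linear X -> N}) :
  cancel a b -> Hom_exact d0 d1 X -> Hom_exact d0 d1 N.
Proof.
move=> ab hX f fd; have [x|g gE] := hX (a \o f); first by rewrite /= fd linear0.
by exists (b \o g) => x; rewrite /= gE ab.
Qed.

Lemma Gorenstein_injective_iso_closed (R : pzRingType) :
  iso_closed (@Gorenstein_injective R).
Proof.
move=> M N f f_inj f_surj [C C_ac [phi phi_inj phi_ker]].
exists C => //; exists (phi \o f); first exact: inj_comp.
rewrite -phi_ker; apply/seteqP; split=> _ [x _ <-]; first by exists (f x).
by have [y <-] := f_surj x; exists y.
Qed.

Section GorensteinHomExact.
Variables (R : pzRingType) (Om Q : nat -> lmodType R).
Variables (i : forall j, {linear Om j.+1 -> Q j}) (p : forall j, {linear Q j -> Om j}).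
Hypothesis Q_proj : forall j, projective_module (Q j).
Hypothesis ip : forall j, short_exact (i j) (p j).
Hypothesis Om0_inj : injective_module (Om 0%N).

Let d j : {linear Q j.+1 -> Q j} := i j \o p j.+1.

(** Let J be [Om 0] and K^l the kernels of the complex. As Hom(J, C) is acyclic, maps J -> K^(l+1)
    lift to C^l, so Ext^1(J, K^l) = 0 for all l; shifting from K^l to K^(l+1) gives the higher
    degrees, and G is isomorphic to K^0. *)
Lemma Hom_exact_Gorenstein_injective j (G : lmodType R) :
  Gorenstein_injective G -> Hom_exact (d j.+1) (d j) G.
Proof.
move=> [C [C_inj C_ac C_hom] [phi phi_inj phi_ker]].
have /choice[K kK] l : exists K : lmodType R, exists k : {linear K -> cobj C l},
    injective k /\ forall x, codiff C l x = 0 <-> exists y, k y = x.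
  apply: submodule_inclusion.
  by split=> [|a u v du dv]; rewrite ?linear0 // linearP du dv scaler0 addr0.
pose k l : {linear K l -> cobj C l} := sval (cid (kK l)).
have k_inj l : injective (k l) by case: (svalP (cid (kK l))).
have k_ker l x : codiff C l x = 0 <-> exists y, k l y = x.
  by case: (svalP (cid (kK l))).
have ses l : exists q : {linear cobj C l -> K (l + 1)},
    (forall x, k (l + 1) (q x) = codiff C l x) /\ short_exact (k l) q.
  have [x|q qE] := linear_factor_inj (f := codiff C l) (@k_inj (l + 1)).
    by apply/k_ker; exact: codiffK.
  exists q; split=> //; split=> // [y|z].
    rewrite -k_ker -qE; split=> [->|]; first exact: linear0.
    by rewrite -[RHS](linear0 (k (l + 1))) => /k_inj.
  have /exact_atP/(_ (k (l + 1) z))[+ _] := C_ac l.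
  case=> [|x xE]; first by apply/k_ker; exists z.
  by exists x; apply: k_inj; rewrite qE.
have hK n l : Hom_exact (d n.+1) (d n) (K l).
  elim: n l => [|n IHn] l; have [q [qE kq]] := ses l.
    apply: (Hom_exact_of_lift ip kq) => // f.
    have [x|g gE] := C_hom _ Om0_inj l (k (l + 1) \o f).
      by apply/k_ker; exists (f x).
    by exists g => x; apply: k_inj; rewrite qE; exact: gE.
  apply: (Hom_exact_sub (d2 := d n) kq) => //.
  - by move=> x; apply/(resolution_exact ip); exists x.
  - exact: (Hom_exact_injective (resolution_exact ip (j := n.+1))).
have phiP x : (codiff C 0 x = 0) <-> exists y, phi y = x.
  have -> : (codiff C 0 x = 0) = kernel (codiff C 0) x by [].
  by rewrite -phi_ker; split=> -[y]; exists y.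
have [x|a aE] := linear_factor_inj (f := phi) (@k_inj 0).
  by apply/k_ker/phiP; exists x.
have [x|b bE] := linear_factor_inj (f := k 0) phi_inj.
  by apply/phiP/k_ker; exists x.
apply: (Hom_exact_retract (a := a) (b := b)) (hK j 0) => x.
by apply: phi_inj; rewrite bE aE.
Qed.

Lemma Hom_exact_Gorenstein_dim m j (X : lmodType R) :
  dim_le (@Gorenstein_injective R) m X -> (m <= j)%N ->
  Hom_exact (d j.+1) (d j) X.
Proof.
elim: m j X => [|m IHm] j X /=; first by move=> /Hom_exact_Gorenstein_injective.
case: j => // j [G [X' [u [v [G_gi uv X'm]]]]] mj.
apply: (Hom_exact_sub (d2 := d j) uv) => //.
- by move=> x; apply/(resolution_exact ip); exists x.
- exact: Hom_exact_Gorenstein_injective.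
- exact: IHm.
Qed.
End GorensteinHomExact.

(** The sequences given by the first two hypotheses are spliced into a complex, infinite in both
    directions, with all kernels in [Z]; lifting against these kernels is the acyclicity of Hom(J,
    -). *)
Lemma Gorenstein_injective_of_class (R : pzRingType) (Z : lmodType R -> Prop) :
  (forall C, Z C -> exists (E C' : lmodType R) (i : {linear C -> E})
     (p : {linear E -> C'}), [/\ injective_module E, short_exact i p & Z C']) ->
  (forall C, Z C -> exists (E C' : lmodType R) (i : {linear C' -> E})
     (p : {linear E -> C}), [/\ injective_module E, short_exact i p & Z C']) ->
  (forall (J C V W : lmodType R) (i : {linear C -> V}) (p : {linear V -> W})
     (f : {linear J -> W}), Z C -> injective_module J -> short_exact i p ->
     exists g : {linear J -> V}, forall x, p (g x) = f x) ->
  forall C, Z C -> Gorenstein_injective C.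
Proof.
move=> next_ex prev_ex lift C ZC.
pose zC : {C | Z C} := exist _ C ZC.
have /choice[next nextP] (c : {C | Z C}) : exists c' : {C | Z C},
    exists (E : lmodType R) (i : {linear sval c -> E}) (p : {linear E -> sval c'}),
    injective_module E /\ short_exact i p.
  have [E [C' [i [p [E_inj ip ZC']]]]] := next_ex _ (svalP c).
  by exists (exist _ C' ZC'), E, i, p.
have /choice[prev prevP] (c : {C | Z C}) : exists c' : {C | Z C},
    exists (E : lmodType R) (i : {linear sval c' -> E}) (p : {linear E -> sval c}),
    injective_module E /\ short_exact i p.
  have [E [C' [i [p [E_inj ip ZC']]]]] := prev_ex _ (svalP c).
  by exists (exist _ C' ZC'), E, i, p.
pose X (l : int) := match l with
  | Posz n => iter n next zC | Negz n => iter n.+1 prev zC end.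
have /choice[E EP] (l : int) : exists E : lmodType R, exists (i : {linear sval (X l) -> E})
    (p : {linear E -> sval (X (l + 1))}), injective_module E /\ short_exact i p.
  case: l => [n|n].
    have -> : n%:Z + 1 = n.+1 by rewrite addrC -intS.
    exact: nextP.
  (* Negz n is -(n+1), so its successor is -n, where [X] is [iter n prev zC] also for n = 0. *)
  have -> : Negz n + 1 = - n%:Z by rewrite NegzE -addn1 PoszD opprD subrK.
  have -> : X (- n%:Z) = iter n prev zC by case: n.
  exact: prevP.
pose i l : {linear sval (X l) -> E l} := sval (cid (EP l)).
have i_ex l := svalP (cid (EP l)).
pose p l : {linear E l -> sval (X (l + 1))} := sval (cid (i_ex l)).
have E_inj l : injective_module (E l) by case: (svalP (cid (i_ex l))).
have ip l : short_exact (i l) (p l) by case: (svalP (cid (i_ex l))).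
pose d l : {linear E l -> E (l + 1)} := i (l + 1) \o p l.
have d0 l x : d l x = 0 <-> exists y, i l y = x.
  have [_ ker_p _] := ip l; have [i_inj _ _] := ip (l + 1).
  rewrite -ker_p /d /=; split=> [|->]; last exact: linear0.
  by rewrite -[RHS](linear0 (i (l + 1))) => /i_inj.
have dd l x : d (l + 1) (d l x) = 0 by apply/d0; exists (p l x).
exists (CochainComplex dd).
  split=> //= [l|J J_inj l f /= df].
    apply/exact_atP => y /=; split=> [/d0[z <-]|[x <-]]; last exact: dd.
    by have [_ _ /(_ z)[x <-]] := ip l; exists x.
  have [i_inj _ _] := ip (l + 1).
  have [x|g gE] := linear_factor_inj (f := f) i_inj; first exact/d0/df.
  have [h hE] := lift J _ _ _ (i l) (p l) g (svalP (X l)) J_inj (ip l).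
  by exists h => x /=; rewrite hE gE.
exists (i 0 : {linear C -> E 0}); first by case: (ip 0).
apply/seteqP; split=> y; first by move=> [x _ <-]; apply/d0; exists x.
by move=> /d0[x <-]; exists x.
Qed.

(** The zero module serves as cokernel and as kernel, and a short exact sequence that starts with an
    injective module splits. *)
Lemma injective_Gorenstein_injective (R : pzRingType) (E : lmodType R) :
  injective_module E -> Gorenstein_injective E.
Proof.
apply: Gorenstein_injective_of_class => {}E.
- move=> E_inj; exists E, (row_module R 0), (idfun : {linear E -> E}), \0.
  split=> //; last exact: zero_injective.
  split=> // [y|z]; first by split=> // _; exists y.
  by exists 0; apply/funext; case.
- move=> E_inj; exists E, (row_module R 0), \0, (idfun : {linear E -> E}).
  split=> //; last exact: zero_injective.
  split=> [x y _|y|z]; first by apply/funext; case.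
    by split=> [/= ->|[_ <-] //]; exists 0.
  by exists z.
move=> C V W i p f C_inj _ [i_inj ip p_surj].
have [r ri] := injective_extension (idfun : {linear C -> C}) C_inj i_inj.
have [g gE] := linear_sub (idfun : {linear V -> V}) (i \o r).
have [x /ip[z <-]|s sE] := linear_factor_surj (f := g) p_surj.
  by rewrite gE /= ri subrr.
exists (s \o f) => x /=; have [y <-] := p_surj (f x).
by rewrite sE gE linearB /= (_ : p (i _) = 0) ?subr0 //; apply/ip; exists (r y).
Qed.

(** * Cosyzygies and trace modules *)

Lemma injective_prod (R : pzRingType) (D E : lmodType R) :
  injective_module D -> injective_module E ->
  injective_module ((D * E)%type : lmodType R).
Proof.
move=> D_inj E_inj A B i f i_inj.
have [a u v|f1 f1E] := @linear_of_fun R A D (fun x => (f x).1); first by rewrite linearP.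
have [a u v|f2 f2E] := @linear_of_fun R A E (fun x => (f x).2); first by rewrite linearP.
have [g1 g1E] := injective_extension f1 D_inj i_inj.
have [g2 g2E] := injective_extension f2 E_inj i_inj.
have [a u v|g gE] := @linear_of_fun R B (D * E)%type (fun x => (g1 x, g2 x)).
  by rewrite !linearP.
by exists g => x /=; rewrite gE g1E g2E f1E f2E -surjective_pairing.
Qed.

(** Given embeddings of Z in D and of M in E, extending the first to F embeds F in D x E; the three
    cokernels again form a short exact sequence, and the construction is iterated. *)
Lemma cosyzygy_horseshoe (R : pzRingType) n (Z F M C : lmodType R)
    (i : {linear Z -> F}) (p : {linear F -> M}) :
  short_exact i p -> cosyzygy n M C ->
  exists (Z' F' : lmodType R) (i' : {linear Z' -> F'}) (p' : {linear F' -> C}),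
    [/\ short_exact i' p', cosyzygy n Z Z' & cosyzygy n F F'].
Proof.
elim: n Z F M i p => [|n IHn] Z F M i p ip /=.
  by move=> MC; subst C; exists Z, F, i, p.
move=> [E [M' [j [q [E_inj [j_inj jq q_surj] M'C]]]]].
have [i_inj ker_p p_surj] := ip.
have [D [_ [a [_ [D_inj [a_inj _ _]]]]]] := enough_injectives Z.
have [al alE] := injective_extension a D_inj i_inj.
pose DE : lmodType R := (D * E)%type.
have [b u v|phi phiE] := @linear_of_fun R F DE (fun x => (al x, j (p x))).
  by rewrite !linearP.
have phi_inj : injective phi.
  move=> x y /eqP; rewrite -subr_eq0 -linearB phiE => /eqP[al0 jp0].
  have /ker_p[z zE] : p (x - y) = 0 by apply: j_inj; rewrite jp0 linear0.
  apply/eqP; rewrite -subr_eq0 -zE (_ : z = 0) ?linear0 //.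
  by apply: a_inj; rewrite -alE zE al0 linear0.
have [F' [r phir]] := cokernel_short_exact phi_inj.
have [_ ker_r r_surj] := phir.
have [b u v|qq qqE] := @linear_of_fun R DE M' (fun x => q x.2); first by rewrite linearP.
have [x /ker_r[y <-]|p' p'E] := linear_factor_surj (f := qq) r_surj.
  by rewrite qqE phiE /=; apply/jq; exists (p y).
have p'_surj y : exists x, p' x = y.
  by have [e <-] := q_surj y; exists (r (0, e)); rewrite p'E qqE.
have [Z'' [k kp']] := kernel_short_exact p'_surj.
have [k_inj ker_p' _] := kp'.
have [b u v|c0 c0E] := @linear_of_fun R D F' (fun x => r (x, 0)).
  rewrite -linearP; congr (r _).
  by rewrite -[RHS]/(b *: u + v, b *: 0 + 0) scaler0 addr0.
have [x|c cE] := linear_factor_inj (f := c0) k_inj.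
  by apply/ker_p'; rewrite c0E p'E qqE linear0.
(* Z'' was obtained as the kernel of F' -> M'; it is also the cokernel of [a]. *)
have ac : short_exact a c.
  split=> // [x|z].
    have -> : c x = 0 <-> r (x, 0) = 0.
      rewrite -c0E -cE; split=> [->|]; first exact: linear0.
      by rewrite -[RHS](linear0 k) => /k_inj.
    rewrite ker_r; split=> [[y]|[z <-]]; last first.
      exists (i z); rewrite phiE alE (_ : p (i z) = 0) ?linear0 //.
      by apply/ker_p; exists z.
    rewrite phiE => -[<- jp0]; have /ker_p[z <-] : p y = 0.
      by apply: j_inj; rewrite jp0 linear0.
    by exists z; rewrite alE.
  have [[x e] xeE] := r_surj (k z).
  have /jq[m jm] : q e = 0.
    have <- : p' (k z) = q e by rewrite -xeE p'E qqE.
    by apply/ker_p'; exists z.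
  have [y ym] := p_surj m; exists (x - al y); apply: k_inj.
  rewrite cE c0E -xeE; have -> : (x - al y, 0) = (x, e) - phi y :> DE.
    by rewrite phiE ym jm -[RHS]/(x - al y, e - e) subrr.
  by rewrite linearB (_ : r (phi y) = 0) ?subr0 //; apply/ker_r; exists y.
have [Z' [F'' [i' [p'' [ip' Z'Z F'F]]]]] := IHn _ _ _ k p' kp' M'C.
exists Z', F'', i', p''; split=> //; first by exists D, Z'', a, c.
by exists DE, F', phi, r; split=> //; exact: injective_prod.
Qed.

(** Maps N -> X factor through [iota], so (1, 0) is a sum of images of maps N -> R x M. Applying (r,
    m) |-> r x shows that [x] lies in the trace of N, which is the range of [iota]. *)
Lemma trace_submodule_generator (R : pzRingType) (M X : lmodType R)
    (iota : {linear ((R^o * M)%type : lmodType R) -> X}) :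
  injective iota -> trace_submodule (range iota) -> forall x, exists y, iota y = x.
Proof.
move=> iota_inj [N NE] x; pose RM : lmodType R := (R^o * M)%type.
have [a u v|phi phiE] := @linear_of_fun R RM X (fun y => (y.1 : R) *: x).
  by rewrite /= scalerDl scalerA.
have lift (al : {linear N -> X}) : exists be : {linear N -> RM},
    forall y, iota (be y) = al y.
  apply: linear_factor_inj => // y.
  have : @trace_module R N X (al y) by exists [:: (al, y)]; rewrite big_seq1.
  by rewrite -NE => -[z _ <-]; exists z.
have /choice[be beE] := lift.
have : range iota (iota (1, 0)) by exists (1, 0).
rewrite NE => -[s sE].
have : @trace_module R N X x.
  exists [seq (phi \o be z.1 : {linear N -> X}, z.2) | z <- s].
  rewrite big_map /= -linear_sum (_ : \sum_(z <- s) _ = (1, 0)) ?phiE ?scale1r //.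
  apply: iota_inj; rewrite sE linear_sum; apply: eq_bigr => z _.
  by rewrite beE.
by rewrite -NE => -[y _ <-]; exists y.
Qed.

(** * The two implications, for a pair of anti-isomorphic rings *)

Section MainDirections.
Variables (R S : pzRingType) (s : R -> S) (t : S -> R).
Hypothesis st : anti_isomorphism s t.
Hypothesis Sn : left_noetherian S.

Lemma Gorenstein_injective_dim_of_injective_dim n m :
  left_noetherian R -> injective_dim_le (R^o : lmodType R) n ->
  injective_dim_le (S^o : lmodType S) m ->
  forall M : lmodType R, Gorenstein_injective_dim_le M n.
Proof.
move=> Rn /injective_dim_leP[CR RC CR_inj] /injective_dim_leP[CS SC CS_inj].
have cosyz_inj (L C : lmodType R) : tensor_acyclic L -> cosyzygy n L C -> injective_module C.
  exact: (tensor_acyclic_cosyzygy Rn RC CR_inj).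
have lift (J M C V W : lmodType R) (u : {linear C -> V}) (v : {linear V -> W})
    (f : {linear J -> W}) : cosyzygy n M C -> injective_module J ->
    short_exact u v -> exists g : {linear J -> V}, forall x, v (g x) = f x.
  move=> MC J_inj; have [Om [Q [i [p [Om0 Q_proj ip]]]]] := projective_resolution J.
  subst J; apply: (lift_of_Hom_exact Q_proj ip).
  have dP := Hom_exact_cosyzygy (fun j => Q_proj j) (resolution_exact ip).
  apply/(dP _ _ _ MC)/(Hom_exact_syzygy ip).
  have Om_ac j : tensor_acyclic (Om j).
    elim: j => [|j IHj]; first exact: (tensor_acyclic_injective st SC).
    exact: (tensor_acyclic_kernel st Sn (ip j)).
  (* The syzygy [Om n.+1] is tensor-acyclic, so that [C'] is injective and Ext^(n+1)(J, Om n.+1) =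
     0. *)
  have [C' OmC'] := cosyzygy_exists n (Om n.+1).
  apply/(dP _ _ _ OmC')/(Hom_exact_injective (resolution_exact ip (j := 0))).
  exact: cosyz_inj OmC'.
have cosyz_Gor (C : lmodType R) : (exists M, cosyzygy n M C) -> Gorenstein_injective C.
  apply: (@Gorenstein_injective_of_class R (fun C => exists M, cosyzygy n M C)).
  - move=> {}C [M MC]; have [E [C' [i [p [E_inj ip]]]]] := enough_injectives C.
    (* The module [C'] is an (n+1)-st cosyzygy of [M], hence an n-th cosyzygy of a first cosyzygy
       [M']. *)
    have [_ [M' [_ [_ [_ _ M'C]]]]] := cosyzygy_append MC ip E_inj.
    by exists E, C', i, p; split=> //; exists M'.
  - move=> {}C [M MC]; have [Z [F [i [p [F_proj ip]]]]] := enough_projectives M.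
    have [Z' [F' [i' [p' [ip' ZZ' FF']]]]] := cosyzygy_horseshoe ip MC.
    exists F', Z', i', p'; split=> //; last by exists Z.
    by apply: cosyz_inj FF'; exact: tensor_acyclic_projective.
  - by move=> J {}C V W u v f [M MC]; exact: lift MC.
have dim_cosyz l (M C : lmodType R) : cosyzygy l M C -> Gorenstein_injective C ->
    dim_le (@Gorenstein_injective R) l M.
  elim: l M => [|l IHl] M /=; first by move=> ->.
  move=> [E [M' [i [p [E_inj ip M'C]]]]] C_gor; exists E, M', i, p; split=> //.
    exact: injective_Gorenstein_injective.
  exact: IHl.
move=> M; have [C MC] := cosyzygy_exists n M; exists n => //.
apply: has_coresolution_of_dim_le; apply: dim_cosyz (MC) _.
by apply: cosyz_Gor; exists M.
Qed.

Lemma injective_dim_of_trace n :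
  (forall M : lmodType R, exists2 X : lmodType R,
     Gorenstein_injective_dim_le X n & trace_up_to_iso M X) ->
  injective_dim_le (S^o : lmodType S) n.
Proof.
move=> tr; apply/injective_dim_leP.
have [C SC] := cosyzygy_exists n (S^o : lmodType S); exists C => //.
apply: (cosyzygy_injective Sn SC) => k D D_ex.
(* Exactness of Hom_S(D, S) in degree n + 1 becomes exactness over [R] of the transposed complex
   [B]. *)
suff /(row_exact_transpose (anti_isomorphism_sym st))[] :
  row_exact (transpose t (D n)) (transpose t (D n.+1)) by [].
pose B i := transpose t (D i).
have [_ tK _ _] := st.
have B_ex i : column_exact (B i) (B i.+1).
  by apply/(row_exact_transpose st); rewrite !transposeK.
apply: exact_of_Hom_exact => [|J]; first exact: (B_ex n).1.
have [Om [Q [i [p [Om0 Q_proj ip]]]]] := projective_resolution J.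
subst J => J_inj.
have Om_proj : projective_module (Om n).
  apply: (syzygy_projective Q_proj ip).
  (* The summand [R] forces X to be all of R x Om n.+1; the other summand is the module whose Ext
     has to vanish. *)
  have [X [m mn Xm] [iota iota_inj tr_iota]] := tr ((R^o * Om n.+1)%type : lmodType R).
  have iota_surj := trace_submodule_generator iota_inj tr_iota.
  have [x|inv invE] := linear_factor_inj (f := (idfun : {linear X -> X})) iota_inj.
    exact: iota_surj.
  have [a u v|pr prE] :=
    @linear_of_fun R (R^o * Om n.+1)%type (Om n.+1) (fun y => y.2); first by [].
  have [a u v|inc incE] :=
    @linear_of_fun R (Om n.+1) (R^o * Om n.+1)%type (fun y => (0, y)).
    by rewrite -[RHS]/(a *: 0 + 0, a *: u + v) scaler0 addr0.
  apply: (Hom_exact_retract (a := iota \o inc) (b := pr \o inv)) => [y|].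
    rewrite /= (_ : inv (iota _) = inc y) ?prE ?incE //.
    by apply: iota_inj; rewrite invE.
  apply: (Hom_exact_Gorenstein_dim Q_proj ip J_inj _ mn).
  by apply: dim_le_of_has_coresolution Xm; exact: Gorenstein_injective_iso_closed.
(* Along 0 -> Om j.+1 -> Q j -> Om j -> 0, exactness passes from the projective [Om n] at l = 0 down
   to the injective [Om 0] at l = n. *)
have step l j : (l + j = n)%N -> Hom_exact (rows (B l)) (rows (B l.+1)) (Om j).
  elim: l j => [|l IHl] j ljn.
    by rewrite add0n in ljn; rewrite ljn; exact: Hom_exact_projective.
  apply: (Hom_exact_quotient (ip j) _ (B_ex l).1).
  - exact: row_module_projective.
  - by apply: IHl; rewrite addnS -addSn.
  - exact: Hom_exact_projective.
by apply: step; rewrite addn0.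
Qed.
End MainDirections.

Lemma trace_up_to_iso_refl (R : pzRingType) (M : lmodType R) : trace_up_to_iso M M.
Proof.
exists (idfun : {linear M -> M}) => //; exists M; apply/seteqP; split=> x _.
  by exists [:: (idfun : {linear M -> M}, x)]; rewrite big_seq1.
by exists x.
Qed.

Theorem theorem4p11 (R : pzRingType) (n : nat)
  (hl : left_noetherian R) (hr : right_noetherian R) :
  Iwanaga_Gorenstein_dim_le R n <->
  (forall M : lmodType R, exists2 X : lmodType R,
     Gorenstein_injective_dim_le X n & trace_up_to_iso M X) /\
  (forall M : lmodType R^c, exists2 X : lmodType R^c,
     Gorenstein_injective_dim_le X n & trace_up_to_iso M X).
Proof.
(* Products in [R^c] are those of [R] reversed, on the same elements. *)
have st : @anti_isomorphism R R^c id id by [].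
have ts : @anti_isomorphism R^c R id id by [].
split=> [[_ Rl Rr]|[trl trr]].
  split=> M; exists M; try exact: trace_up_to_iso_refl.
    exact: (Gorenstein_injective_dim_of_injective_dim st hr hl Rl Rr).
  exact: (Gorenstein_injective_dim_of_injective_dim ts hl hr Rr Rl).
(* The sides cross: left modules bound the right injective dimension, and right modules the left
   one. *)
have Rr := injective_dim_of_trace st hr trl.
have Rl := injective_dim_of_trace ts hl trr.
by split=> //; split=> //; exists n.
Qed.
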